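(* Any state formula $\phi$ of $\mathrm{CTL}^*[\exists,\forall,\mathbb P_{>0},\mathbb P_{=1}]$ on alphabet $\Sigma$ can be effectively transformed into a formula $\phi'$ of size linear in that of $\phi$ on the alphabet $\Sigma\cup\{\circ\}$, where $\circ\notin\Sigma$ is a fresh letter, such that $\phi$ is a positive instance of MC-SAT iff $\phi'$ is a positive instance of BIN-SAT. Consequently MC-SAT linearly reduces to BIN-SAT. Moreover this transformation maps formulas of the fragment $\mathrm{CTL}^*[\mathbb P_{>0},\mathbb P_{=1}]$ to formulas of that same fragment.
   Context: A $\Sigma$-labelled Markov chain is $\mathcal M=(S,p,t)$ with $S$ countable, $p:S\to\Delta(S)$, $t:S\to\Sigma$; $\mathbb P_{\mathcal M,s}$ is the induced measure on infinite sequences from $s$; a path is a sequence $s_0s_1\dots$ with $p(s_i,s_{i+1})>0$, and $w[k]$ is the suffix of $w$ from position $k$. A $\Sigma$-labelled binary tree $t:\{0,1\}^*\to\Sigma$ is regarded as the Markov chain with states $\{0,1\}^*$, labelling $t$, and probability $1/2$ of going from $n$ to each of $n0$ and $n1$. Logic $\mathrm{CTL}^*[\exists,\forall,\mathbb P_{>0},\mathbb P_{=1}]$: state formulas $\phi::=\top\mid\bot\mid a\mid\phi\wedge\phi\mid\phi\vee\phi\mid\neg\phi\mid\exists\psi\mid\forall\psi\mid\mathbb P_{>0}(\psi)\mid\mathbb P_{=1}(\psi)$; path formulas $\psi::=\phi\mid\neg\psi\mid\psi\wedge\psi\mid\psi\vee\psi\mid X\psi\mid\psi U\psi\mid G\psi$.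 Semantics: $s\models a$ iff $t(s)=a$; $s\models\exists\psi$ / $\forall\psi$ iff some / every infinite path from $s$ satisfies $\psi$; $s\models\mathbb P_{>0}(\psi)$ / $\mathbb P_{=1}(\psi)$ iff the probability of paths from $s$ satisfying $\psi$ is $>0$ / $=1$; a path satisfies a state formula iff its first state does; $w\models X\psi$ iff $w[1]\models\psi$; $w\models G\psi$ iff $\forall i,\ w[i]\models\psi$; $w\models\psi_1U\psi_2$ iff $\exists n$, $w[n]\models\psi_2$ and $w[i]\models\psi_1$ for $i<n$. $\mathrm{CTL}^*[\mathbb P_{>0},\mathbb P_{=1}]$ is the sublogic without $\exists,\forall$. MC-SAT: given a formula, decide whether some Markov chain $\mathcal M$ and state $s$ satisfy $\mathcal M,s\models\xi$. BIN-SAT: given a formula, decide whether some binary tree (seen as Markov chain), at some node, satisfies it. *)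

(* Defs.v *)
From HB Require Import structures.
From mathcomp Require Import all_boot all_order all_algebra.
From mathcomp Require Import all_classical all_reals all_analysis.

Set Implicit Arguments.
Unset Strict Implicit.
Unset Printing Implicit Defensive.

Import Order.TTheory GRing.Theory Num.Theory.
Import numFieldNormedType.Exports.

Local Open Scope classical_set_scope.
Local Open Scope ring_scope.

Record markov_chain (R : realType) (Sigma : Type) := MarkovChain {
  mc_state :> countType;
  mc_trans : mc_state -> mc_state -> R;
  mc_label : mc_state -> Sigma;
  mc_trans_ge0 : forall x y, 0 <= mc_trans x y;
  mc_trans_sum1 :
    forall x, (\esum_(y in [set: mc_state]) (mc_trans x y)%:E = 1)%E }.

Arguments mc_trans {R Sigma} m x y.
Arguments mc_label {R Sigma} m x.

Definition cylinder (S : countType) (w : seq S) : set (nat -> S) :=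
  [set x | mkseq x (size w) = w].

Definition cylinders (S : countType) : set (set (nat -> S)) :=
  range (@cylinder S).

(* The library requires measurable spaces to be pointed, hence the state [s],
   which plays no other role. *)
Definition sequences_from (S : countType) (s : S) : Type := nat -> S.

Section sequences_from.
Variables (S : countType) (s : S).
HB.instance Definition _ := Choice.copy (sequences_from s) (nat -> S).
HB.instance Definition _ := isPointed.Build (sequences_from s) (fun=> s).
End sequences_from.

Definition path_space (S : countType) (s : S) :=
  @g_sigma_algebraType (sequences_from s) (@cylinders S).

HB.instance Definition _ (S : countType) (s : S) :=
  Measurable.on (path_space s).

Section path_measure.
Variables (R : realType) (Sigma : Type) (M : markov_chain R Sigma).
Implicit Types (x y s : M) (w : seq M).

Fixpoint word_weight x w : R :=
  if w is y :: w' then mc_trans M x y * word_weight y w' else 1.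

Definition cylinder_weight s w : R :=
  if w is x :: w' then (x == s)%:R * word_weight x w' else 1.

(* Existence: from the state x, attached to a half-open interval [a, a + l[, the
   successor of index n (in the enumeration of the countable state space) gets
   the subinterval [a + l F n, a + l F n.+1[, where F is the cumulative
   distribution function of [mc_trans M x].  Following the nested intervals that
   contain a uniformly distributed u yields a random sequence of states with the
   expected cylinder probabilities. *)

Let q x (n : nat) : R := if @pickle_inv M n is Some y then mc_trans M x y else 0.
Let F x (n : nat) : R := \sum_(0 <= i < n) q x i.

Let q_ge0 x n : 0 <= q x n.
Proof. by rewrite /q; case: pickle_inv => // y; exact: mc_trans_ge0. Qed.

Let q_pickle x y : q x (pickle y) = mc_trans M x y.
Proof. by rewrite /q pickleK_inv. Qed.

Let FS x n : F x n.+1 = F x n + q x n.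
Proof. by rewrite /F big_nat_recr. Qed.

Let F_le x m n : (m <= n)%N -> F x m <= F x n.
Proof.
elim: n => [|n IH]; first by rewrite leqn0 => /eqP->.
rewrite leq_eqVlt => /predU1P[->//|]; rewrite ltnS => /IH /le_trans-> //.
by rewrite FS lerDl.
Qed.

Let sum_q x : (\sum_(0 <= i <oo) (q x i)%:E = 1)%E.
Proof.
rewrite nneseries_esumT; last by move=> n; rewrite lee_fin.
rewrite (esumID (range (@pickle M))); last by move=> n _; rewrite lee_fin.
rewrite setTI [X in (_ + X)%E]esum1 ?adde0; last first.
  move=> n [_ nP]; rewrite /q; case E : (pickle_inv n) => [y|//].
  exfalso; apply: nP; exists y => //.
  have := @pickle_invK M n; rewrite /oapp E /= => H; exact: H.
rewrite esum_image; last by move=> y z _ _; exact: (pcan_inj (@pickleK M)).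
rewrite -(mc_trans_sum1 x); apply: eq_esum => y _.
by rewrite q_pickle.
Qed.

Let F_gt x (v : R) : v < 1 -> exists n, v < F x n.
Proof.
move=> v1; apply: contrapT => /forallNP H.
have : (\sum_(0 <= i <oo) (q x i)%:E <= v%:E)%E.
  apply: lime_le; first by apply: is_cvg_nneseries => n _ _; rewrite lee_fin.
  apply: nearW => n /=; rewrite sumEFin lee_fin leNgt; apply/negP; exact: H.
by rewrite sum_q lee_fin leNgt v1.
Qed.

Let cell x (a l u : R) : set nat :=
  [set n | a + l * F x n <= u < a + l * F x n.+1].

Let cell_ex x (a l u : R) : a <= u < a + l -> exists n, cell x a l u n.
Proof.
move=> /andP[au ul].
have l0 : 0 < l by rewrite -(ltrD2l a) addr0; exact: le_lt_trans ul.
have H n : (u < a + l * F x n) = ((u - a) / l < F x n).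
  by rewrite ltr_pdivrMr// ltrBlDl [F x n * l]mulrC.
have [|n] := @F_gt x ((u - a) / l).
  by rewrite ltr_pdivrMr// mul1r ltrBlDl.
rewrite -H; elim: n => [|n IH].
  by rewrite /F big_geq// mulr0 addr0 ltNge au.
have [/IH//|h1 h2] := ltP u (a + l * F x n).
by exists n; rewrite /cell/= h1 h2.
Qed.

Let cell_uniq x (a l u : R) m n : 0 <= l ->
  cell x a l u m -> cell x a l u n -> m = n.
Proof.
move=> l0.
wlog mn : m n / (m < n)%N.
  move=> H hm hn; case: (ltngtP m n) => [mn|nm|//]; first exact: H.
  by apply/esym; exact: H.
move=> /andP[_ h1] /andP[h2 _]; exfalso.
have := le_lt_trans h2 h1; rewrite ltrD2l ltNge => /negP; apply.
by rewrite ler_wpM2l// F_le.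
Qed.

Let next (u : R) (c : M * R * R) : M * R * R :=
  let: (x, a, l) := c in
  let n := xget 0%N (cell x a l u) in
  (odflt x (pickle_inv n), a + l * F x n, l * q x n).

Let trajectory (u : R) (c : M * R * R) : nat -> M :=
  fun k => (iter k (next u) c).1.1.

Let trajectoryS u c k : trajectory u c k.+1 = trajectory u (next u c) k.
Proof. by rewrite /trajectory iterSr. Qed.

Let mkseqS (f : nat -> M) n :
  mkseq f n.+1 = f 0%N :: mkseq (fun k => f k.+1) n.
Proof. by rewrite /mkseq /= (iotaDl 1 0) -map_comp. Qed.

Let trajectory_word w : forall x (a l : R), 0 <= l ->
  exists b : R,
    [set u | a <= u < a + l /\
             mkseq (fun k => trajectory u (x, a, l) k.+1) (size w) = w] =
    [set u | b <= u < b + l * word_weight x w].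
Proof.
elim: w => [|y w IH] x a l l0.
  by exists a; rewrite /= mulr1; apply/seteqP; split=> u //= [].
have lq : 0 <= l * q x (pickle y) by rewrite mulr_ge0.
have [b Hb] := IH y (a + l * F x (pickle y)) _ lq.
exists b; rewrite /= -q_pickle mulrA -Hb.
apply/seteqP; split=> u /=.
  move=> [ul]; have cn := xgetPex 0%N (cell_ex x ul).
  rewrite mkseqS => -[]; rewrite trajectoryS {1}/trajectory /=.
  set n := xget _ _ in cn *.
  have qn : 0 < q x n.
    move: cn => /andP[h1 h2]; move: (le_lt_trans h1 h2).
    rewrite FS ltrD2l mulrDr ltrDl => h; rewrite lt_neqAle q_ge0 andbT.
    by apply/eqP => e; move: h; rewrite -e mulr0 ltxx.
  have [z ez] : exists z : M, pickle_inv n = Some z.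
    by move: qn; rewrite /q; case: pickle_inv => [z _|]; [exists z|rewrite ltxx].
  rewrite ez /= => zy; rewrite {z}zy in ez.
  have en : n = pickle y.
    by have := @pickle_invK M n; rewrite /oapp ez /= => <-.
  move=> Hw; split; first by move: cn; rewrite en /cell/= FS mulrDr addrA.
  rewrite -[in RHS]Hw; apply/eq_map => k /=.
  by rewrite [in RHS]trajectoryS /next -/n ez /= en.
move=> [ul Hw].
have cy : cell x a l u (pickle y) by rewrite /cell/= FS mulrDr addrA.
have ul' : a <= u < a + l.
  have F0 n : 0 <= F x n by apply: sumr_ge0.
  have F1 n : F x n <= 1.
    rewrite -lee_fin -(sum_q x) /F -sumEFin.
    by apply: nneseries_lim_ge => i _; rewrite lee_fin.
  move: cy => /andP[h1 h2]; apply/andP; split.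
    by apply: le_trans h1; rewrite lerDl mulr_ge0.
  by apply: lt_le_trans h2 _; rewrite lerD2l ler_piMr.
have en : xget 0%N (cell x a l u) = pickle y.
  by apply: cell_uniq l0 (xgetPex _ (cell_ex x ul')) cy.
have enx : next u (x, a, l) =
    (y, a + l * F x (pickle y), l * q x (pickle y)).
  by rewrite /next en pickleK_inv.
split=> //; rewrite mkseqS; congr (_ :: _); first by rewrite trajectoryS enx.
by rewrite -[in RHS]Hw; apply/eq_map => k /=; rewrite trajectoryS enx.
Qed.

Let U : set (measurableTypeR R) := [set` `[0, 1[%R].
Let mU : measurable U. Proof. exact: measurable_itv. Qed.

Let X s (u : R) : path_space s :=
  trajectory (if (0 <= u < 1) then u else 0) (s, 0, 1).

Let trajectory_cylinder s w : exists b : R,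
  [set u | 0 <= u < 1 /\ cylinder w (X s u)] =
  [set` `[b, b + cylinder_weight s w[%R].
Proof.
case: w => [|x w].
  exists 0; apply/seteqP; split=> u /=; rewrite in_itv/= add0r.
    by case.
  by rewrite /cylinder.
have [->|xs] := eqVneq x s; last first.
  exists 0; rewrite /cylinder_weight (negbTE xs) mul0r addr0 set_itvco0.
  apply/seteqP; split=> // u [_] [sx]; move: xs.
  by rewrite -sx /X /trajectory /= eqxx.
rewrite /cylinder_weight eqxx mul1r.
have [b Hb] := @trajectory_word w s 0 1 ler01.
exists b; move: Hb; rewrite add0r mul1r => Hb.
transitivity [set u | b <= u < b + word_weight s w]; last first.
  by apply/seteqP; split=> u /=; rewrite in_itv.
rewrite -Hb; apply/seteqP; split=> u /= [u01].
  by rewrite /cylinder [size _]/= /mkset mkseqS /X u01 => -[] Hw.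
move=> Hw; split=> //; rewrite /cylinder [size _]/= /mkset mkseqS /X u01.
by rewrite Hw.
Qed.

Let measurable_X s : measurable_fun [set: measurableTypeR R] (X s).
Proof.
apply: (@measurability _ _ (measurableTypeR R) (path_space s) setT (X s) (@cylinders M)) => //.
move=> _ [_ [w _ <-] <-].
have [b Hb] := trajectory_cylinder s w.
rewrite setTI (_ : _ @^-1` _ =
    [set u | 0 <= u < 1 /\ cylinder w (X s u)] `|`
    (if `[< cylinder w (X s 0) >] then ~` U else set0)).
  apply: measurableU; first by rewrite Hb; exact: measurable_itv.
  by case: ifP => _ //; apply: measurableC.
have UE u : U u = (0 <= u < 1) by rewrite /U/= in_itv.
have X0 u : ~~ (0 <= u < 1) -> X s u = X s 0.
  by move=> /negbTE h; rewrite /X h; case: ifP.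
apply/seteqP; split=> u /=.
  move=> Xu; have [u01|u01] := boolP (0 <= u < 1); [by left|right].
  rewrite ifT; last by apply/asboolP; rewrite -(X0 u).
  by move=> Uu; move/negP: u01; apply; rewrite -UE.
move=> [[]//|]; case: asboolP => // X0w Uu.
by rewrite (X0 u)//; apply/negP; rewrite -UE.
Qed.

Definition is_path_measure s (mu : probability (path_space s) R) :=
  forall w, mu (cylinder w) = (cylinder_weight s w)%:E.

Let cylinder_nil : cylinder ([::] : seq M) = setT.
Proof. by apply/seteqP; split. Qed.

Lemma word_weight_ge0 x w : 0 <= word_weight x w.
Proof. by elim: w x => //= y w IH x; rewrite mulr_ge0// mc_trans_ge0. Qed.

Lemma cylinder_weight_ge0 s w : 0 <= cylinder_weight s w.
Proof.
by case: w => //= x w; rewrite mulr_ge0// ?ler0n// word_weight_ge0.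
Qed.

Lemma ex_path_measure s :
  exists mu : probability (path_space s) R, is_path_measure mu.
Proof.
pose lam : {measure set (measurableTypeR R) -> \bar R} :=
  mrestr (@lebesgue_measure R) mU.
pose nu : set (path_space s) -> \bar R := pushforward lam (X s).
have nuE w : nu (cylinder w) = (cylinder_weight s w)%:E.
  have [b Hb] := trajectory_cylinder s w.
  transitivity (lebesgue_measure [set` `[b, b + cylinder_weight s w[%R]).
    rewrite -Hb /nu /pushforward /lam /= /mrestr; congr lebesgue_measure.
    by apply/seteqP; split=> u /= [].
  rewrite lebesgue_measure_itv /= lte_fin ltrDl; case: ltP => h.
    by rewrite -EFinB addrAC subrr add0r.
  by congr (_%:E); apply/eqP; rewrite eq_le h cylinder_weight_ge0.
have nu0 : nu set0 = 0%E by exact: measure0.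
have nu_ge0 A : (0 <= nu A)%E by exact: measure_ge0.
have nu_add : semi_sigma_additive nu.
  move=> A mA tA mUA; rewrite /nu /pushforward preimage_bigcup.
  apply: measure_semi_sigma_additive.
  - by move=> n; rewrite -[X in measurable X]setTI; exact: measurable_X.
  - apply/trivIsetP => /= i j _ _ ij; rewrite -preimage_setI.
    by move/trivIsetP : tA => /(_ _ _ _ _ ij) ->//; rewrite preimage_set0.
  - by rewrite -preimage_bigcup -[X in measurable X]setTI; exact: measurable_X.
have nuT : nu setT = 1%E by rewrite -cylinder_nil nuE.
pose M1 := isMeasure.Build _ _ _ nu nu0 nu_ge0 nu_add.
pose mu : {measure set (path_space s) -> \bar R} := HB.pack nu M1.
pose M2 := Measure_isProbability.Build _ (path_space s) R mu nuT.
pose P : probability (path_space s) R :=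
  HB.pack (Measure.sort mu) M2.
by exists P.
Qed.

Lemma path_measure_unique s (mu nu : probability (path_space s) R) :
  is_path_measure mu -> is_path_measure nu ->
  forall A, measurable A -> mu A = nu A.
Proof.
move=> muE nuE A mA.
pose G : set (set (path_space s)) := [set B | B = set0 \/ cylinders B].
have GT : G setT by right; exists [::].
apply: (g_sigma_algebra_measure_unique G _ (fun=> setT)) => //.
- move=> B [->|cB]; [exact: measurable0|exact: sub_sigma_algebra].
- by apply/seteqP; split => // x _; exists 0%N.
- have H (x : nat -> M) m n : (m <= n)%N -> mkseq x m = take m (mkseq x n).
    by move=> mn; rewrite /mkseq -map_take take_iota; move/minn_idPl: mn => ->.
  have GI (v w : seq M) : (size v <= size w)%N ->
      G (cylinder v `&` cylinder w).
    move=> vw; have [e|ne] := eqVneq v (take (size v) w).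
      right; exists w => //; apply/seteqP; split=> x /=; last by case.
      by rewrite /cylinder/= => e'; split => //; rewrite (H _ _ _ vw) e'.
    left; apply/seteqP; split=> x //=; rewrite /cylinder/= => -[e1 e2].
    by move: ne; rewrite -e1 -[in X in take _ X]e2 size_mkseq (H _ _ _ vw) eqxx.
  move=> B C [->|[v _ <-]]; first by rewrite set0I; left.
  move=> [->|[w _ <-]]; first by rewrite setI0; left.
  by case/orP: (leq_total (size v) (size w)) => [/GI//|/GI]; rewrite setIC.
- move=> B [->|[w _ <-]]; first by rewrite !measure0.
  exact: etrans (muE w) (esym (nuE w)).
- by move=> _; apply: (@le_lt_trans _ _ 1%E); rewrite ?ltry ?probability_le1.
- apply: (@sub_smallest2r _ _ (@cylinders M) G) mA.
    exact: smallest_sigma_algebra.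
  by move=> B cB; right.
Qed.

Definition path_measure s : probability (path_space s) R :=
  projT1 (cid (ex_path_measure s)).

Lemma path_measureE s w :
  path_measure s (cylinder w) = (cylinder_weight s w)%:E.
Proof. exact: (projT2 (cid (ex_path_measure s))). Qed.

End path_measure.

Definition is_path (R : realType) (Sigma : Type) (M : markov_chain R Sigma)
    (w : nat -> M) : Prop :=
  forall i, 0 < mc_trans M (w i) (w i.+1).

Section tree_chain.
Variables (R : realType) (Sigma : Type) (t : seq bool -> Sigma).

Definition tree_trans (n m : seq bool) : R :=
  if (m == rcons n false) || (m == rcons n true) then 2^-1 else 0.

Let tree_trans_ge0 n m : 0 <= tree_trans n m.
Proof. by rewrite /tree_trans; case: ifP. Qed.

Let tree_trans_sum1 n :
  (\esum_(m in [set: seq bool]) (tree_trans n m)%:E = 1)%E.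
Proof.
pose a := rcons n false; pose b := rcons n true.
have ab : a != b by rewrite eqseq_rcons andbF.
have h0 m : (0 <= (tree_trans n m)%:E)%E by rewrite lee_fin tree_trans_ge0.
rewrite (esumID [set a]) // (esumID [set b] (_ `&` ~` _)) //.
rewrite [X in (_ + (_ + X))%E]esum1; last first.
  move=> m [[_ /= /eqP ma] /eqP mb].
  by rewrite /tree_trans (negbTE ma) (negbTE mb).
rewrite adde0 setTI (_ : _ `&` [set b] = [set b]); last first.
  apply/seteqP; split=> m /=; first by case.
  by move=> ->; split => //; split=> // /esym/eqP; apply/negP.
by rewrite !esum_set1// /tree_trans /a /b !eqxx orbT -EFinD -[2^-1]mul1r -splitr.
Qed.

Definition tree_chain : markov_chain R Sigma :=
  @MarkovChain R Sigma (seq bool) tree_trans t tree_trans_ge0 tree_trans_sum1.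

End tree_chain.

Section syntax.
Variable Sigma : Type.

Inductive state_formula : Type :=
  | STrue
  | SFalse
  | SAtom of Sigma
  | SAnd of state_formula & state_formula
  | SOr of state_formula & state_formula
  | SNot of state_formula
  | SExists of path_formula
  | SForall of path_formula
  | SProbPos of path_formula
  | SProbOne of path_formula
with path_formula : Type :=
  | PState of state_formula
  | PNot of path_formula
  | PAnd of path_formula & path_formula
  | POr of path_formula & path_formula
  | PNext of path_formula
  | PUntil of path_formula & path_formula
  | PGlobally of path_formula.

(* [PState] is not a symbol of the concrete syntax and is not counted. *)
Fixpoint state_size (phi : state_formula) : nat :=
  match phi with
  | STrue | SFalse | SAtom _ => 1
  | SAnd phi1 phi2 | SOr phi1 phi2 => (state_size phi1 + state_size phi2).+1
  | SNot phi1 => (state_size phi1).+1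
  | SExists psi | SForall psi | SProbPos psi | SProbOne psi =>
      (path_size psi).+1
  end
with path_size (psi : path_formula) : nat :=
  match psi with
  | PState phi => state_size phi
  | PAnd psi1 psi2 | POr psi1 psi2 | PUntil psi1 psi2 =>
      (path_size psi1 + path_size psi2).+1
  | PNot psi1 | PNext psi1 | PGlobally psi1 => (path_size psi1).+1
  end.

Fixpoint state_prob_only (phi : state_formula) : bool :=
  match phi with
  | STrue | SFalse | SAtom _ => true
  | SAnd phi1 phi2 | SOr phi1 phi2 =>
      state_prob_only phi1 && state_prob_only phi2
  | SNot phi1 => state_prob_only phi1
  | SExists _ | SForall _ => false
  | SProbPos psi | SProbOne psi => path_prob_only psi
  end
with path_prob_only (psi : path_formula) : bool :=
  match psi with
  | PState phi => state_prob_only phi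
  | PAnd psi1 psi2 | POr psi1 psi2 | PUntil psi1 psi2 =>
      path_prob_only psi1 && path_prob_only psi2
  | PNot psi1 | PNext psi1 | PGlobally psi1 => path_prob_only psi1
  end.

End syntax.

Arguments STrue {Sigma}.
Arguments SFalse {Sigma}.

Definition suffix (S : Type) (w : nat -> S) (k : nat) : nat -> S :=
  fun i => w (k + i)%N.

Section semantics.
Variables (R : realType) (Sigma : Type) (M : markov_chain R Sigma).

Fixpoint state_sat (s : M) (phi : state_formula Sigma) : Prop :=
  match phi with
  | STrue => True
  | SFalse => False
  | SAtom a => mc_label M s = a
  | SAnd phi1 phi2 => state_sat s phi1 /\ state_sat s phi2
  | SOr phi1 phi2 => state_sat s phi1 \/ state_sat s phi2
  | SNot phi1 => ~ state_sat s phi1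
  | SExists psi => exists w : nat -> M, [/\ w 0%N = s, is_path w & path_sat w psi]
  | SForall psi => forall w : nat -> M, w 0%N = s -> is_path w -> path_sat w psi
  | SProbPos psi => (0 < path_measure s [set w | path_sat w psi])%E
  | SProbOne psi => path_measure s [set w | path_sat w psi] = 1%E
  end
with path_sat (w : nat -> M) (psi : path_formula Sigma) : Prop :=
  match psi with
  | PState phi => state_sat (w 0%N) phi
  | PNot psi1 => ~ path_sat w psi1
  | PAnd psi1 psi2 => path_sat w psi1 /\ path_sat w psi2
  | POr psi1 psi2 => path_sat w psi1 \/ path_sat w psi2
  | PNext psi1 => path_sat (suffix w 1) psi1
  | PUntil psi1 psi2 =>
      exists n, path_sat (suffix w n) psi2 /\
                forall i, (i < n)%N -> path_sat (suffix w i) psi1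
  | PGlobally psi1 => forall i, path_sat (suffix w i) psi1
  end.

End semantics.

Definition MC_SAT (R : realType) (Sigma : Type)
    (phi : state_formula Sigma) : Prop :=
  exists (M : markov_chain R Sigma) (s : M), state_sat s phi.

Definition BIN_SAT (R : realType) (Sigma : Type)
    (phi : state_formula Sigma) : Prop :=
  exists (t : seq bool -> Sigma) (n : tree_chain R t), state_sat n phi.

Inductive connective :=
  | CTrue | CFalse | CAnd | COr | CNot | CExists | CForall | CProbPos | CProbOne
  | CState | CPNot | CPAnd | CPOr | CNext | CUntil | CGlobally.

Definition connectives : seq connective :=
  [:: CTrue; CFalse; CAnd; COr; CNot; CExists; CForall; CProbPos; CProbOne;
      CState; CPNot; CPAnd; CPOr; CNext; CUntil; CGlobally].

Definition connective_index (c : connective) : 'I_16 :=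
  match c with
  | CTrue => inord 0 | CFalse => inord 1 | CAnd => inord 2 | COr => inord 3
  | CNot => inord 4 | CExists => inord 5 | CForall => inord 6
  | CProbPos => inord 7 | CProbOne => inord 8 | CState => inord 9
  | CPNot => inord 10 | CPAnd => inord 11 | CPOr => inord 12 | CNext => inord 13
  | CUntil => inord 14 | CGlobally => inord 15
  end.

Lemma connective_indexK :
  pcancel connective_index (fun i : 'I_16 => onth connectives i).
Proof. by case; rewrite /= inordK. Qed.

HB.instance Definition _ := Finite.copy connective (pcan_type connective_indexK).

Definition symbol (Sigma : Type) : Type := (connective + Sigma)%type.

HB.instance Definition _ (Sigma : finType) := Finite.on (symbol Sigma).

(* Prefix (Polish) notation.  The Boolean connectives of the two sorts are kept
   apart and [CState] marks the passage from path to state formulas, which makes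
   the encoding injective. *)
Section code.
Variable Sigma : Type.
Implicit Types (phi : state_formula Sigma) (psi : path_formula Sigma).

Fixpoint state_code phi : seq (symbol Sigma) :=
  match phi with
  | STrue => [:: inl CTrue]
  | SFalse => [:: inl CFalse]
  | SAtom a => [:: inr a]
  | SAnd phi1 phi2 => inl CAnd :: state_code phi1 ++ state_code phi2
  | SOr phi1 phi2 => inl COr :: state_code phi1 ++ state_code phi2
  | SNot phi1 => inl CNot :: state_code phi1
  | SExists psi => inl CExists :: path_code psi
  | SForall psi => inl CForall :: path_code psi
  | SProbPos psi => inl CProbPos :: path_code psi
  | SProbOne psi => inl CProbOne :: path_code psi
  end
with path_code psi : seq (symbol Sigma) :=
  match psi with
  | PState phi => inl CState :: state_code phi
  | PNot psi1 => inl CPNot :: path_code psi1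
  | PAnd psi1 psi2 => inl CPAnd :: path_code psi1 ++ path_code psi2
  | POr psi1 psi2 => inl CPOr :: path_code psi1 ++ path_code psi2
  | PNext psi1 => inl CNext :: path_code psi1
  | PUntil psi1 psi2 => inl CUntil :: path_code psi1 ++ path_code psi2
  | PGlobally psi1 => inl CGlobally :: path_code psi1
  end.

Lemma state_code_cat_inj phi phi' r r' :
  state_code phi ++ r = state_code phi' ++ r' -> phi = phi' /\ r = r'
with path_code_cat_inj psi psi' r r' :
  path_code psi ++ r = path_code psi' ++ r' -> psi = psi' /\ r = r'.
Proof.
- case: phi => [||a|p q|p q|p|p|p|p|p];
  case: phi' => [||a'|p' q'|p' q'|p'|p'|p'|p'|p'] //=;
  rewrite -?catA => -[].
  + by [].
  + by [].
  + by move=> -> ->.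
  + by move=> /state_code_cat_inj[-> /state_code_cat_inj[-> ->]].
  + by move=> /state_code_cat_inj[-> /state_code_cat_inj[-> ->]].
  + by move=> /state_code_cat_inj[-> ->].
  + by move=> /path_code_cat_inj[-> ->].
  + by move=> /path_code_cat_inj[-> ->].
  + by move=> /path_code_cat_inj[-> ->].
  + by move=> /path_code_cat_inj[-> ->].
- case: psi => [p|p|p q|p q|p|p q|p];
  case: psi' => [p'|p'|p' q'|p' q'|p'|p' q'|p'] //=;
  rewrite -?catA => -[].
  + by move=> /state_code_cat_inj[-> ->].
  + by move=> /path_code_cat_inj[-> ->].
  + by move=> /path_code_cat_inj[-> /path_code_cat_inj[-> ->]].
  + by move=> /path_code_cat_inj[-> /path_code_cat_inj[-> ->]].
  + by move=> /path_code_cat_inj[-> ->].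
  + by move=> /path_code_cat_inj[-> /path_code_cat_inj[-> ->]].
  + by move=> /path_code_cat_inj[-> ->].
Qed.

Lemma state_code_inj : injective state_code.
Proof.
move=> phi phi' e; apply: (proj1 (state_code_cat_inj (r := [::]) (r' := [::]) _)).
by rewrite e.
Qed.

End code.

Inductive move := MLeft | MStay | MRight.

(* Tapes are infinite to the right only; [None] is the blank symbol.  The
   machine has [tm_extra.+2] tapes: the first one is the input tape and the last
   one the output tape.  It halts when [tm_delta] yields [None]. *)
Record machine (A B : finType) := Machine {
  tm_extra : nat;
  tm_work : finType;
  tm_ctrl : finType;
  tm_start : tm_ctrl;
  tm_delta :
    tm_ctrl -> {ffun 'I_tm_extra.+2 -> option (A + B + tm_work)} ->
    option (tm_ctrl *
            ('I_tm_extra.+2 -> option (A + B + tm_work) * move)) }.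

Section run.
Variables (A B : finType) (T : machine A B).

Definition tape := nat -> option (A + B + tm_work T).

Record config := Config {
  cf_ctrl : tm_ctrl T;
  cf_tape : 'I_(tm_extra T).+2 -> tape;
  cf_head : 'I_(tm_extra T).+2 -> nat }.

Definition apply_move (m : move) (p : nat) : nat :=
  match m with MLeft => p.-1 | MStay => p | MRight => p.+1 end.

Definition step (c : config) : option config :=
  if tm_delta (cf_ctrl c) [ffun i => cf_tape c i (cf_head c i)]
    is Some (q, act) then
    Some (Config q
      (fun i p => if p == cf_head c i then (act i).1 else cf_tape c i p)
      (fun i => apply_move (act i).2 (cf_head c i)))
  else None.

Definition initial (v : seq A) : config :=
  Config (tm_start T)
    (fun i p => if i == ord0 then omap (fun a => inl (inl a)) (onth v p)
                else None)
    (fun=> 0%N).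

Definition computes_in (n : nat) (v : seq A) (v' : seq B) : Prop :=
  exists c : config,
    [/\ iter n (obind step) (Some (initial v)) = Some c,
        step c = None &
        forall p, cf_tape c ord_max p =
                  omap (fun b => inl (inr b)) (onth v' p)].

End run.

Section reductions.
Variables Sigma Sigma' : finType.

Definition computable (f : state_formula Sigma -> state_formula Sigma') : Prop :=
  exists T : machine (symbol Sigma) (symbol Sigma'),
    forall phi, exists n, computes_in T n (state_code phi) (state_code (f phi)).

Definition linear_time_computable
    (f : state_formula Sigma -> state_formula Sigma') : Prop :=
  exists (T : machine (symbol Sigma) (symbol Sigma')) (c : nat),
    forall phi, exists2 n, (n <= c * size (state_code phi))%N &
      computes_in T n (state_code phi) (state_code (f phi)).

Definition linearly_reduces (P : state_formula Sigma -> Prop)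
    (Q : state_formula Sigma' -> Prop) : Prop :=
  exists f : state_formula Sigma -> state_formula Sigma',
    [/\ linear_time_computable f,
        exists c : nat, forall phi, (state_size (f phi) <= c * state_size phi)%N &
        forall phi, P phi <-> Q (f phi)].

End reductions.

(* Main.v *)
Require Import Defs.
From HB Require Import structures.
From mathcomp Require Import all_boot all_order all_algebra.
From mathcomp Require Import all_classical all_reals all_analysis.
From mathcomp Require Import zify lra.

(** A branch of the binary tree can simulate a Markov chain by coin tosses: the
nodes labelled by the fresh letter are intermediate tosses, and each visible node
stands for a state. For one direction, the successors of a state are
given consecutive half-open cells of [0, 1[ of lengths their probabilities, and a
successor is chosen as soon as the dyadic interval of the tosses made since the
last choice lies in its cell; this gives the exact transition probabilities, and
almost surely infinitely many visible nodes. Conversely, in a tree where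
almost every branch is visible infinitely often, the first-return
probabilities between visible nodes form a Markov chain. In both cases erasing
the invisible nodes maps the branch measure of the tree to the path measure of the
chain, since the cylinder weights agree. The formula is translated so that a path
formula at an invisible position speaks about the next visible one; until and
globally then need no change, and the translation replaces each symbol of the
Polish notation by a fixed word, which a machine does in linear time. *)

Set Implicit Arguments.
Unset Strict Implicit.
Unset Printing Implicit Defensive.

Local Notation suffix := Defs.suffix.

(** * Machines for word morphisms *)

Section morphism_machine.
Variables (A B : finType) (w0 : seq B) (h : A -> seq B).

Let bound := maxn (size w0) (\max_(a : A) size (h a)).

Let h_bound a : size (h a) <= bound.
Proof. by rewrite leq_max (leq_bigmax (F := fun a => size (h a))) orbT. Qed.

(** Words of bounded length form a finite type, as the control states of a machine must. *)
Let queue := bound.-bseq B.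

Let delta (q : queue) (r : {ffun 'I_0.+2 -> option (A + B + void)}) :
    option (queue * ('I_0.+2 -> option (A + B + void) * move)) :=
  match (q : seq B) with
  | b :: q' => Some (insub_bseq bound q', fun i =>
      if i == ord0 then (r i, MStay) else (Some (inl (inr b)), MRight))
  | [::] =>
      if r ord0 is Some (inl (inl a)) then
        Some (insub_bseq bound (h a), fun i =>
          if i == ord0 then (r i, MRight) else (r i, MStay))
      else None
  end.

(* The control state is the word still to be written. *)
Definition morphism_machine : machine A B :=
  @Machine A B 0 void queue (insub_bseq bound w0) delta.

(** Invariant of a run: [q] remains to be written, [o] has been written, and the first [p] input
    letters have been consumed. *)
Let running (v : seq A) (c : config morphism_machine) (q : seq B) p
    (o : seq B) : Prop :=
  [/\ cf_ctrl c = q :> seq B,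
      forall k, cf_tape c ord0 k = omap (fun a => inl (inl a)) (onth v k),
      cf_head c ord0 = p,
      forall k, cf_tape c ord_max k = omap (fun b => inl (inr b)) (onth o k) &
      cf_head c ord_max = size o].

Let insub_queue (q : seq B) : size q <= bound -> insub_bseq bound q = q :> seq B.
Proof. by move=> qb; rewrite /insub_bseq insubdK. Qed.

Let running_write v c b q p o : running v c (b :: q) p o ->
  exists2 c', step c = Some c' & running v c' q p (rcons o b).
Proof.
move=> [cq c0 h0 c1 h1]; rewrite /step /= /delta cq /=.
eexists; first by [].
have qb : size q <= bound by rewrite ltnW // (leq_trans _ (size_bseq (cf_ctrl c))) ?cq.
split=> /=.
- exact: insub_queue.
- by move=> k; case: eqP => [->|]; rewrite ?ffunE.
- by [].
- move=> k; rewrite h1 -cats1 onth_cat; case: ltngtP => [ko|ko|->].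
  + exact: c1.
  + by rewrite c1 !onth_default //= ?subn_gt0 // ltnW.
  + by rewrite subnn.
- by rewrite h1 size_rcons.
Qed.

Let running_read v c p o : running v c [::] p o ->
  if onth v p is Some a then
    exists2 c', step c = Some c' & running v c' (h a) p.+1 o
  else step c = None.
Proof.
move=> [cq c0 h0 c1 h1]; rewrite /step /= /delta cq /= ffunE c0 h0.
case: onth => [a|//] /=; eexists; first by [].
split=> /=.
- exact: insub_queue.
- by move=> k; case: eqP => [->|]; rewrite ?ffunE.
- by rewrite h0.
- by move=> k; case: eqP => [->|]; rewrite ?ffunE.
- by rewrite h1.
Qed.

Let running_flush v c q p o : running v c q p o ->
  exists2 c', iter (size q) (obind (@step A B morphism_machine)) (Some c) = Some c' & running v c' [::] p (o ++ q).
Proof.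
elim: q c o => [|b q IH] c o rc; first by exists c; rewrite ?cats0.
have [c1 s1 /IH[c2 i2]] := running_write rc.
by rewrite cat_rcons => r2; exists c2; rewrite // [size _]/= iterSr /= s1.
Qed.

(** Each input letter costs one reading step and at most [bound] writing steps; the additional round
    pays for flushing the initial queue. *)
Let running_halt v c q p o : running v c q p o -> size q <= bound ->
  exists n c', [/\ n <= (size v - p).+1 * bound.+1,
    iter n (obind (@step A B morphism_machine)) (Some c) = Some c',
    step c' = None & forall k, cf_tape c' ord_max k =
       omap (fun b => inl (inr b)) (onth (o ++ q ++ flatten (map h (drop p v))) k)].
Proof.
move: {-1}(size v - p) (leqnn (size v - p)) => m.
elim: m c q p o => [|m IH] c q p o mp rc qb.
  have [c1 i1 r1] := running_flush rc.
  have pv : size v <= p by rewrite -subn_eq0 -leqn0.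
  exists (size q), c1; split=> //; first by rewrite mulSn (leq_trans qb) // addSn leqW // leq_addr.
    by move: (running_read r1); rewrite onth_default.
  by rewrite drop_oversize // cats0; case: r1.
have [c1 i1 r1] := running_flush rc.
(* [m] only bounds the number of unread letters, so the input may be exhausted in this case too. *)
have [vp|pv] := leqP (size v) p.
  exists (size q), c1; split=> //; first by rewrite mulSn (leq_trans qb) // addSn leqW // leq_addr.
    by move: (running_read r1); rewrite onth_default.
  by rewrite drop_oversize // cats0; case: r1.
move: (running_read r1); case E : (onth v p) => [a|]; last first.
  by move: pv; rewrite -onthTE E.
move=> [c2 s2 /IH[||n [c3 [n3 i3 s3 t3]]]]; [by lia|exact: h_bound|].
exists (n + (size q).+1), c3; split=> //.
  by rewrite [m.+2 * _]mulSn addnC leq_add.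
  by rewrite iterD iterS i1 /= s2.
move=> k; rewrite t3 (drop_nth a pv) /= -!catA.
by rewrite -(odflt_onth a) E.
Qed.

Lemma morphism_machine_computes v : exists2 n,
  (n <= (size v).+1 * bound.+1)%N &
  computes_in morphism_machine n v (w0 ++ flatten (map h v)).
Proof.
have [||n [c [n1 i1 s1 t1]]] := @running_halt v (initial morphism_machine v) w0 0 [::].
- split=> //=; first by rewrite insub_queue // leq_maxl.
  by move=> k; rewrite /onth /= ; case: k.
- exact: leq_maxl.
exists n; first by rewrite subn0 in n1.
by exists c; split=> // k; rewrite t1 drop0.
Qed.

End morphism_machine.

Scheme state_formula_mut := Induction for state_formula Sort Prop
  with path_formula_mut := Induction for path_formula Sort Prop.
Combined Scheme formula_ind from state_formula_mut, path_formula_mut.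

(** * The translation *)

Section translation.
Variable Sigma : Type.
Implicit Types (phi : state_formula Sigma) (psi : path_formula Sigma).

Let circ : state_formula (option Sigma) := SAtom None.

(** Evaluates [chi] at the first visible position: the left argument of the until forces every
    earlier position to be invisible. *)
Definition after_circ (chi : path_formula (option Sigma)) :=
  PUntil (PState circ) (PAnd (PState (SNot circ)) chi).

Definition infinitely_visible : path_formula (option Sigma) :=
  PGlobally (PUntil (PState STrue) (PState (SNot circ))).

(** Path quantifiers must be restricted to branches that stand for a path of the chain. The
    probabilistic operators need no restriction, since the other branches will have probability
    zero. *)
Fixpoint tr_state phi : state_formula (option Sigma) :=
  match phi with
  | STrue => STrue
  | SFalse => SFalse
  | SAtom a => SAtom (Some a)
  | SAnd phi1 phi2 => SAnd (tr_state phi1) (tr_state phi2)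
  | SOr phi1 phi2 => SOr (tr_state phi1) (tr_state phi2)
  | SNot phi1 => SNot (tr_state phi1)
  | SExists psi => SExists (PAnd infinitely_visible (tr_path psi))
  | SForall psi => SForall (POr (PNot infinitely_visible) (tr_path psi))
  | SProbPos psi => SProbPos (tr_path psi)
  | SProbOne psi => SProbOne (tr_path psi)
  end
with tr_path psi : path_formula (option Sigma) :=
  match psi with
  | PState phi => after_circ (PState (tr_state phi))
  | PNot psi1 => PNot (tr_path psi1)
  | PAnd psi1 psi2 => PAnd (tr_path psi1) (tr_path psi2)
  | POr psi1 psi2 => POr (tr_path psi1) (tr_path psi2)
  | PNext psi1 => after_circ (PNext (tr_path psi1))
  | PUntil psi1 psi2 => PUntil (tr_path psi1) (tr_path psi2)
  | PGlobally psi1 => PGlobally (tr_path psi1)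
  end.

(** The two conjuncts in front of the translation ensure that the node stands for a state and that
    first returns below it are almost sure. *)
Definition bin_formula phi : state_formula (option Sigma) :=
  SAnd (SAnd (SNot circ) (SProbOne infinitely_visible)) (tr_state phi).

(** [PState] does not count in the size although its translation adds 5 symbols, hence the slack of
    5 for state formulas. The translated [SForall] has 8 symbols of its own, and 8 + 5 gives the
    factor 13. *)
Lemma tr_size :
  (forall phi, state_size (tr_state phi) + 5 <= 13 * state_size phi) /\
  (forall psi, path_size (tr_path psi) <= 13 * path_size psi).
Proof. by apply: formula_ind => //= *; lia. Qed.

Lemma bin_formula_size phi : state_size (bin_formula phi) <= 22 * state_size phi.
Proof.
have [/(_ phi) + _] := tr_size; rewrite /bin_formula /=.
lia.
Qed.

Lemma tr_prob_only :
  (forall phi, state_prob_only phi -> state_prob_only (tr_state phi)) /\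
  (forall psi, path_prob_only psi -> path_prob_only (tr_path psi)).
Proof.
apply: formula_ind => //= [p IHp q IHq|p IHp q IHq|p IHp q IHq|p IHp q IHq|p IHp q IHq]
  /andP[/IHp-> /IHq->] //.
Qed.

Lemma bin_formula_prob_only phi :
  state_prob_only phi -> state_prob_only (bin_formula phi).
Proof. exact: tr_prob_only.1. Qed.

Definition tr_prefix : seq (symbol (option Sigma)) :=
  [:: inl CAnd, inl CAnd, inl CNot, inr None, inl CProbOne &
      path_code infinitely_visible].

(** In prefix notation the operands follow their connective, so each added context can be written
    entirely in front of them. [CState] and [CNext] share a clause because both are translated by
    [after_circ]. *)
Definition tr_symbol (x : symbol Sigma) : seq (symbol (option Sigma)) :=
  match x with
  | inr a => [:: inr (Some a)]
  | inl CExists => [:: inl CExists, inl CPAnd & path_code infinitely_visible]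
  | inl CForall =>
      [:: inl CForall, inl CPOr, inl CPNot & path_code infinitely_visible]
  | inl ((CState | CNext) as c) =>
      inl CUntil :: path_code (PState circ) ++
      inl CPAnd :: path_code (PState (SNot circ)) ++ [:: inl c]
  | inl c => [:: inl c]
  end.

Lemma tr_code :
  (forall phi, state_code (tr_state phi) = flatten (map tr_symbol (state_code phi))) /\
  (forall psi, path_code (tr_path psi) = flatten (map tr_symbol (path_code psi))).
Proof.
by apply: formula_ind => //= p -> // q ->; rewrite map_cat flatten_cat.
Qed.

Lemma bin_formula_code phi :
  state_code (bin_formula phi) =
  tr_prefix ++ flatten (map tr_symbol (state_code phi)).
Proof. by rewrite -tr_code.1. Qed.

End translation.

Lemma bin_formula_linear_time (Sigma : finType) :
  linear_time_computable (@bin_formula Sigma).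
Proof.
pose T := morphism_machine (tr_prefix Sigma) (@tr_symbol Sigma).
eexists T, _ => phi.
have [n] := @morphism_machine_computes _ _ (tr_prefix Sigma) (@tr_symbol Sigma) (state_code phi).
rewrite -bin_formula_code; set b := (X in _ * X.+1) => nb Tn.
exists n => //; apply: leq_trans nb (_ : _ <= (2 * b.+1) * _).
(* A code is nonempty, so the extra round of the machine is absorbed by the factor 2. *)
have : 0 < size (state_code phi) by case: (phi).
by rewrite mulnAC leq_mul2r; case: size => // m _; lia.
Qed.

(** * Erasing the invisible positions of a sequence *)

Lemma suffix0 (S : Type) (w : nat -> S) : suffix w 0 = w.
Proof. by []. Qed.

Lemma suffix_add (S : Type) (w : nat -> S) i j :
  suffix (suffix w i) j = suffix w (i + j).
Proof. by apply/funext => k; rewrite /suffix addnA. Qed.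

Lemma mkseq_suffix (S : Type) (w : nat -> S) n :
  mkseq w n.+1 = w 0 :: mkseq (suffix w 1) n.
Proof. by rewrite /mkseq /= (iotaDl 1 0) -map_comp. Qed.

Section projection.
Variables (N Y : Type) (st : N -> option Y) (y0 : Y).
Implicit Types w : nat -> N.

Definition visible w := forall i, exists j, st (w (i + j)).

Definition first_visible w : nat :=
  if pselect (exists i, isSome (st (w i))) is left e then ex_minn e else 0.

Definition after_visible w := suffix w (first_visible w).+1.

(** On a [visible] sequence the default [y0] is never taken, since a visible position remains after
    every iteration. *)
Definition readout w k : Y :=
  let w' := iter k after_visible w in odflt y0 (st (w' (first_visible w'))).

Lemma visible_suffix w k : visible w -> visible (suffix w k).
Proof. by move=> vw i; have [j] := vw (k + i); exists j; rewrite /suffix addnA. Qed.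

(** Induction on the distance to a later visible position: invisible positions are removed one at a
    time. *)
Lemma visible_ind (P : (nat -> N) -> Prop) :
  (forall w x, visible w -> st (w 0) = Some x -> P w) ->
  (forall w, visible w -> st (w 0) = None -> P (suffix w 1) -> P w) ->
  forall w, visible w -> P w.
Proof.
move=> Psome Pnone w vw; have [j] := vw 0; rewrite add0n.
elim: j w vw => [|j IH] w vw wj.
  by case E: (st (w 0)) wj => [x|//] _; exact: Psome E.
case E: (st (w 0)) => [x|]; first exact: Psome E.
by apply: Pnone => //; apply: IH; [exact: visible_suffix|].
Qed.

Lemma first_visibleP w : visible w ->
  st (w (first_visible w)) /\ forall i, i < first_visible w -> st (w i) = None.
Proof.
move=> vw; rewrite /first_visible; case: pselect => [e|[]]; last first.
  by have [j] := vw 0; exists j.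
case: ex_minnP => m sm mm; split=> // i im; case E: (st (w i)) => [x|//].
by have := mm i; rewrite E leqNgt im => /(_ isT).
Qed.

Lemma first_visible_uniq w n : visible w ->
  st (w n) -> (forall i, i < n -> st (w i) = None) -> first_visible w = n.
Proof.
move=> /first_visibleP[sm mm] sn mn; case: (ltngtP (first_visible w) n) => // h.
  by rewrite mn in sm.
by rewrite mm in sn.
Qed.

Lemma readout_some w x : visible w -> st (w 0) = Some x ->
  readout w 0 = x /\ suffix (readout w) 1 = readout (suffix w 1).
Proof.
move=> vw sx; have f0 : first_visible w = 0.
  by apply: first_visible_uniq; rewrite ?sx.
split; first by rewrite /readout /= f0 sx.
have a1 : after_visible w = suffix w 1 by rewrite /after_visible f0.
by apply/funext => k; rewrite {1}/suffix /readout iterSr a1.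
Qed.

Lemma readout_none w : visible w -> st (w 0) = None -> readout w = readout (suffix w 1).
Proof.
move=> vw sx; have [sm mm] := first_visibleP (visible_suffix 1 vw).
have f1 : first_visible w = (first_visible (suffix w 1)).+1.
  by apply: first_visible_uniq => // -[|i]//; exact: mm.
have a1 : after_visible w = after_visible (suffix w 1).
  by rewrite /after_visible f1 suffix_add.
apply/funext => -[|k]; rewrite /readout; first by rewrite /= f1.
by rewrite !iterSr a1.
Qed.

Lemma readout_first w : visible w ->
  [/\ st (w (first_visible w)) = Some (readout w 0) &
      suffix (readout w) 1 = readout (after_visible w)].
Proof.
move=> vw; have [sm _] := first_visibleP vw; split.
  by move: sm; rewrite /readout /=; case: (st _).
by apply/funext => k; rewrite {1}/suffix /readout iterSr.
Qed.

Lemma pmap_readout w k : visible w ->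
  let s := pmap st (mkseq w k) in mkseq (readout w) (size s) = s.
Proof.
elim: k w => [//|k IH] w vw; rewrite mkseq_suffix /=.
have vw1 := visible_suffix 1 vw.
case E: (st (w 0)) => [x|] /=; last by rewrite readout_none // IH.
by have [p0 p1] := readout_some vw E; rewrite mkseq_suffix p0 p1 IH.
Qed.

(** Converse of [pmap_readout]. The prefix found is empty or stops at a visible position, which is
    the end condition imposed by [hits]. *)
Lemma readout_pmap w j : visible w ->
  exists2 k, pmap st (mkseq w k) = mkseq (readout w) j & (k == 0) || st (w k.-1).
Proof.
elim: j w => [|j IH]; first by move=> w _; exists 0.
apply: visible_ind => [w x vw sx|w vw sx [k pk lk]].
  have [p0 p1] := readout_some vw sx.
  have [k pk lk] := IH _ (visible_suffix 1 vw).
  exists k.+1; first by rewrite !mkseq_suffix /= sx p0 p1 /= pk.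
  by case: k lk {pk} => //= _; rewrite sx.
exists k.+1; first by rewrite mkseq_suffix /= sx readout_none.
by case: k lk pk => //=.
Qed.

End projection.

(** * Until and globally under erasure *)

Section until.
Variables (N Y : Type) (st : N -> option Y) (y0 : Y).
Variables (V : set (nat -> N)).
Hypothesis V_visible : forall w, V w -> visible st w.
Hypothesis V_suffix : forall w k, V w -> V (suffix w k).
Let readout := readout st y0.

(** The positions after one visible position, up to and including the next, all have the same
    readout. Hence [A'] and [B'] are constant on such a block, and a witness on either side yields
    one on the other. *)
Lemma readout_until (A B : (nat -> Y) -> Prop) (A' B' : (nat -> N) -> Prop) :
  (forall w, V w -> A (readout w) <-> A' w) ->
  (forall w, V w -> B (readout w) <-> B' w) ->
  forall w, V w ->
  (exists n, B (suffix (readout w) n) /\ forall i, i < n -> A (suffix (readout w) i)) <->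
  (exists n, B' (suffix w n) /\ forall i, i < n -> A' (suffix w i)).
Proof.
move=> AA' BB' w Vw; split=> -[n [Bn An]].
  (* Here [n] counts visible positions; [visible_ind] crosses the invisible ones in between. *)
  elim: n w Vw Bn An => [|n IH] w Vw Bn An.
    by exists 0; split=> //; apply/BB'.
  have vw := V_visible Vw; move: w vw Vw Bn An.
  apply: visible_ind => [w x vw sw Vw Bn An|w vw sw IHw Vw].
    have [_ p1] := readout_some y0 vw sw.
    have [|k|m [Bm Am]] := IH (suffix w 1) (V_suffix _ Vw).
    - by rewrite /readout -p1 suffix_add.
    - by move=> kn; rewrite /readout -p1 suffix_add add1n; exact: An.
    - exists m.+1; rewrite suffix_add in Bm; split=> // -[_|i im].
        by apply/AA'; rewrite // -[readout w]suffix0; exact: An.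
      by rewrite -[i.+1]add1n -suffix_add; exact: Am.
  rewrite /readout (readout_none y0 vw sw) => Bn An.
  have [m [Bm Am]] := IHw (V_suffix _ Vw) Bn An.
  exists m.+1; rewrite suffix_add in Bm; split=> // -[_|i im].
    apply/AA'; rewrite // /readout (readout_none y0 vw sw) -[X in A X]suffix0; exact: An.
  by rewrite -[i.+1]add1n -suffix_add; exact: Am.
elim: n w Vw Bn An => [|n IH] w Vw Bn An.
  by exists 0; split=> //; rewrite suffix0; apply/BB'.
have [||m [Bm Am]] := IH (suffix w 1) (V_suffix _ Vw).
- by rewrite suffix_add.
- by move=> i im; rewrite suffix_add add1n; exact: An.
(* An invisible first position leaves the readout unchanged, so the witness [m] is kept; a visible
   one shifts it by one. *)
case E: (st (w 0)) => [x|]; last first.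
  by exists m; rewrite /readout (readout_none y0 (V_visible Vw) E).
have [_ p1] := readout_some y0 (V_visible Vw) E.
rewrite /readout -p1 suffix_add in Bm Am.
exists m.+1; split=> // -[_|i im]; first by rewrite suffix0; apply/AA' => //; exact: (An 0).
by have := Am i im; rewrite suffix_add.
Qed.

(** Globally is the dual of an until whose left argument is always true. *)
Lemma readout_globally (A : (nat -> Y) -> Prop) (A' : (nat -> N) -> Prop) :
  (forall w, V w -> A (readout w) <-> A' w) ->
  forall w, V w ->
  (forall i, A (suffix (readout w) i)) <-> (forall i, A' (suffix w i)).
Proof.
move=> AA' w Vw.
have /(_ w Vw) H := @readout_until (fun=> True) (fun x => ~ A x) (fun=> True)
  (fun x => ~ A' x) (fun _ _ => iff_refl _) (fun w Vw => not_iff_compat (AA' w Vw)).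
split=> Aall i; apply: contrapT => nA.
  by have [|n [+ _]] := H.2; [exists i|apply; exact: Aall].
by have [|n [+ _]] := H.1; [exists i|apply; exact: Aall].
Qed.

End until.

Import Order.TTheory GRing.Theory Num.Theory.
Import numFieldNormedType.Exports.

Local Open Scope classical_set_scope.
Local Open Scope ring_scope.

(** * Measurability of path formulas *)


Lemma drop_mkseq (S : Type) (w : nat -> S) k n :
  drop k (mkseq w (k + n)) = mkseq (suffix w k) n.
Proof.
by rewrite /mkseq -map_drop drop_iota addKn add0n -[k in iota k]addn0 iotaDl -map_comp.
Qed.

Section measurability.
Variables (S : countType) (s : S).

Lemma countable_bigcup_measurable d (T : measurableType d) (I : countType)
    (F : I -> set T) :
  (forall i, measurable (F i)) -> measurable (\bigcup_i F i).
Proof. by move=> mF; apply: countable_bigcupT_measurable => //; exact: countableP. Qed.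

Lemma measurable_cylinder (v : seq S) : measurable (cylinder v : set (path_space s)).
Proof. by apply: sub_sigma_algebra; exists v. Qed.

(** There are countably many words over [S], so an event that depends on a prefix is a countable
    union of cylinders. *)
Lemma measurable_prefix n (P : seq S -> Prop) :
  measurable ([set w | P (mkseq w n)] : set (path_space s)).
Proof.
rewrite (_ : mkset _ = \bigcup_v
   (if `[< size v = n /\ P v >] then cylinder v else set0)).
  apply: countable_bigcup_measurable => v.
  by case: ifP => // _; exact: measurable_cylinder.
apply/seteqP; split=> w /=.
  move=> Pw; exists (mkseq w n) => //; rewrite ifT ?size_mkseq //.
    by rewrite /cylinder /= size_mkseq.
  exact/asboolP.
by case=> v _; case: asboolP => // -[<- Pv] /= ->.
Qed.

Lemma measurable_suffix k :
  measurable_fun setT (fun w : path_space s => (suffix w k : path_space s)).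
Proof.
apply: (@measurability _ _ _ (path_space s) setT _ (@cylinders S)) => //.
move=> _ [_ [v _ <-] <-]; rewrite setTI.
rewrite (_ : _ @^-1` _ = [set w | drop k (mkseq w (k + size v)) = v]).
  exact: (measurable_prefix _ (fun u => drop k u = v)).
by apply/seteqP; split=> w; rewrite /cylinder /preimage /= drop_mkseq.
Qed.

End measurability.

(** A state formula constrains only the first state, and every set of states is admissible there. So
    the induction runs on path formulas alone, and the temporal operators are countable unions and
    intersections of shifted events. *)
Lemma measurable_path_sat (R : realType) (Sigma : Type)
    (M : markov_chain R Sigma) (s : M) (psi : path_formula Sigma) :
  measurable ([set w | path_sat w psi] : set (path_space s)).
Proof.
have msuf k A : measurable (A : set (path_space s)) ->
    measurable ([set w | A (suffix w k)] : set (path_space s)).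
  move=> mA; rewrite -[X in measurable X]setTI.
  exact: (measurable_suffix k measurableT).
elim: psi => [phi|psi IH|p IHp q IHq|p IHp q IHq|psi IH|p IHp q IHq|psi IH] /=.
- exact: (@measurable_prefix _ s 1 (fun v => state_sat (head s v) phi)).
- exact: measurableC.
- exact: measurableI.
- exact: measurableU.
- exact: (msuf 1 _ IH).
- rewrite (_ : mkset _ = \bigcup_n ([set w | path_sat (suffix w n) q] `&`
      \bigcap_(i in [set i | (i < n)%N]) [set w | path_sat (suffix w i) p])).
    apply: bigcupT_measurable => n; apply: measurableI; first exact: (msuf n _ IHq).
    by apply: bigcap_measurableType => i _; exact: (msuf i _ IHp).
  apply/seteqP; split=> w /=.
    by move=> [n [qn pn]]; exists n.
  by move=> [n _ [qn pn]]; exists n.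
- rewrite (_ : mkset _ = \bigcap_n [set w | path_sat (suffix w n) psi]).
    by apply: bigcapT_measurable => n; exact: (msuf n _ IH).
  by apply/seteqP; split=> w /= H n *; exact: H.
Qed.

(** * The path measure of a tree *)

Section countable_sums.
Variables (R : realType) (I : countType).
Implicit Types (A : set I).

(** Passing to the codes of the elements makes results on series indexed by naturals applicable. *)
Lemma esum_nneseries A (a : I -> \bar R) : (forall i, A i -> 0 <= a i)%E ->
  (\esum_(i in A) a i = \sum_(k <oo | k \in pickle @` A)
     (if pickle_inv k is Some i then a i else 0))%E.
Proof.
move=> a0; rewrite nneseries_esum; last first.
  by move=> k; rewrite inE => -[i Ai <-]; rewrite pickleK_inv; exact: a0.
rewrite set_mem_set esum_image; last by move=> i j _ _; exact: (pcan_inj (@pickleK I)).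
by apply: eq_esum => i _; rewrite pickleK_inv.
Qed.

Lemma esumZl A (a : I -> \bar R) (c : R) : 0 <= c -> (forall i, A i -> 0 <= a i)%E ->
  (\esum_(i in A) (c%:E * a i) = c%:E * \esum_(i in A) a i)%E.
Proof.
move=> c0 a0; rewrite !esum_nneseries //; last by move=> i Ai; rewrite mule_ge0 ?lee_fin ?a0.
rewrite -nneseriesZl; last first.
  by move=> k; rewrite inE => -[i Ai <-]; rewrite pickleK_inv; exact: a0.
by apply: eq_eseriesr => k _; case: pickle_inv => //; rewrite mule0.
Qed.

Lemma measure_countable_bigcup d (T : measurableType d)
    (mu : {measure set T -> \bar R}) A (F : I -> set T) :
  (forall i, A i -> measurable (F i)) -> trivIset A F ->
  mu (\bigcup_(i in A) F i) = (\esum_(i in A) mu (F i))%E.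
Proof.
move=> mF tF; pose G k := if @pickle_inv I k is Some i then F i else set0.
rewrite (_ : \bigcup_(i in A) F i = \bigcup_(k in pickle @` A) G k); last first.
  by rewrite bigcup_image; apply: eq_bigcupr => i _; rewrite /G pickleK_inv.
rewrite measure_bigcup; first last.
- move=> _ _ [i Ai <-] [j Aj <-]; rewrite /G !pickleK_inv => ij.
  by congr pickle; exact: tF ij.
- by move=> _ [i Ai <-]; rewrite /G pickleK_inv; exact: mF.
rewrite esum_nneseries; last by move=> i Ai; exact: measure_ge0.
by apply: eq_eseriesr => k _; rewrite /G; case: pickle_inv => //; rewrite measure0.
Qed.

End countable_sums.

Lemma probability_bigcap d (T : measurableType d) (R : realType)
    (P : probability T R) (F : (set T)^nat) :
  (forall k, measurable (F k)) -> (forall k, P (F k) = 1%E) ->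
  P (\bigcap_k F k) = 1%E.
Proof.
move=> mF F1; have mI : measurable (\bigcap_k F k) by exact: bigcapT_measurable.
suff : P (~` \bigcap_k F k) = 0%E.
  move=> c0; rewrite -[X in P X]setCK probability_setC; first by rewrite c0 sube0.
  exact: measurableC.
apply/negligibleP; first exact: measurableC.
rewrite setC_bigcap; apply: negligible_bigcup => k.
have c0 : P (~` F k) = 0%E by rewrite probability_setC // F1 subee.
by apply/negligibleP => //; exact: measurableC.
Qed.

Lemma probability_eq d (T : measurableType d) (R : realType)
    (P : probability T R) (G A B : set T) :
  measurable G -> measurable A -> measurable B -> P G = 1%E ->
  (forall x, G x -> A x <-> B x) -> P A = P B.
Proof.
move=> mG mA mB G1 AB.
have PI C : measurable C -> P C = P (C `&` G).
  move=> mC; have -> : P C = (P (C `\` G) + P (C `&` G))%E by exact: measureDI.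
  rewrite (_ : P (C `\` G) = 0%E) ?add0e //.
  apply/eqP; rewrite -measure_le0 (_ : 0%E = P (~` G)); last first.
    by rewrite probability_setC // G1 subee.
  by apply: le_measure; rewrite ?inE //; [exact: measurableD|exact: measurableC].
rewrite PI // [RHS]PI //; congr (P _).
by apply/seteqP; split=> x [+ Gx] => /(AB x Gx).
Qed.

(** * Branches, words of tosses and prefix-free sets *)

Section branches.
Implicit Types (n : seq bool) (u v : seq bool).

Lemma foldl_rcons_cat n u : foldl rcons n u = n ++ u.
Proof. by elim: u n => [|b u IH] n /=; rewrite ?cats0 // IH cat_rcons. Qed.

Definition branch n u := n :: scanl rcons n u.

Lemma size_branch n u : size (branch n u) = (size u).+1.
Proof. by rewrite /= size_scanl. Qed.

(** The Kraft sum of [A]: for a prefix-free [A], the probability that fair tosses begin with a word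
    of [A]. *)
Definition weight (R : realType) (A : set (seq bool)) : \bar R :=
  \esum_(u in A) (2^-1 ^+ size u)%:E.

Definition prefix_free (A : set (seq bool)) :=
  forall u v, A u -> A (u ++ v) -> v = [::].

Definition through n u (w : nat -> seq bool) :=
  forall i, (i <= size u)%N -> w i = n ++ take i u.

Lemma cylinder_branch n u : cylinder (branch n u) = through n u.
Proof.
have nthb i : (i <= size u)%N -> nth [::] (branch n u) i = n ++ take i u.
  by move=> iu; rewrite nth_cons_scanl // foldl_rcons_cat.
apply/seteqP; split=> w.
  rewrite /cylinder /= => wu i iu; rewrite -nthb // -wu size_scanl.
  by rewrite (nth_mkseq _ w).
move=> wu; apply: (@eq_from_nth _ [::]); rewrite size_mkseq // => i iu.
by rewrite size_branch in iu; rewrite nth_mkseq ?size_branch // nthb // wu.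
Qed.

Lemma trivIset_through n (A : set (seq bool)) :
  prefix_free A -> trivIset A (through n).
Proof.
move=> pA u v; wlog uv : u v / (size u <= size v)%N.
  move=> H Au Av [w [wu wv]]; case/orP: (leq_total (size u) (size v)) => h.
    by apply: H => //; exists w.
  by apply/esym; apply: H => //; exists w.
move=> Au Av [w [wu wv]].
have e : u = take (size u) v.
  have := wu (size u) (leqnn _); rewrite wv // take_size => /eqP.
  by rewrite eqseq_cat // eqxx => /eqP.
have := pA u (drop (size u) v); rewrite {2}e cat_take_drop => /(_ Au Av) d0.
by rewrite e -[in RHS](cat_take_drop (size u) v) d0 cats0.
Qed.

End branches.

Section tree_measure.
Variables (R : realType) (Sigma : Type) (t : seq bool -> Sigma).
Let T := tree_chain R t.
Implicit Types (n u v : seq bool).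

Lemma word_weight_branch n u :
  word_weight (M := T) n (scanl rcons n u) = 2^-1 ^+ size u.
Proof.
elim: u n => [|b u IH] n //=; rewrite exprS -(IH (rcons n b)); congr (_ * _).
by rewrite /= /tree_trans; case: b; rewrite eqxx ?orbT.
Qed.

(** Prefix-freeness makes the cylinders disjoint, and each has measure 1/2 to the power of the
    length of its word. *)
Lemma path_measure_bigcup_through n (A : set (seq bool)) : prefix_free A ->
  path_measure (n : T) (\bigcup_(u in A) through n u) = weight R A.
Proof.
move=> pA; rewrite measure_countable_bigcup.
- apply: eq_esum => u _; rewrite -cylinder_branch.
  apply: etrans (path_measureE (n : T) (branch n u)) _.
  by rewrite /cylinder_weight /branch eqxx mul1r word_weight_branch.
- by move=> u _; rewrite -cylinder_branch; exact: measurable_cylinder.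
- exact: trivIset_through.
Qed.

Lemma measurable_bigcup_through n (A : set (seq bool)) :
  measurable (\bigcup_(u in A) through n u : set (path_space (n : T))).
Proof.
rewrite (_ : bigcup _ _ = \bigcup_u (if `[< A u >] then through n u else set0)).
  apply: countable_bigcup_measurable => u; case: ifP => // _.
  by rewrite -cylinder_branch; exact: measurable_cylinder.
apply/seteqP; split=> w [u uA wu]; first by exists u => //; rewrite ifT //; exact/asboolP.
by move: wu; case: asboolP => // Au wu; exists u.
Qed.

Lemma tree_is_path n (w : nat -> seq bool) : w 0%N = n -> is_path (M := T) w ->
  forall k, exists2 u, size u = k & through n u w.
Proof.
move=> w0 pw; elim=> [|k [u uk wu]].
  by exists [::] => // -[|//] _; rewrite cats0.
have [b wk] : exists b, w k.+1 = rcons (w k) b.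
  have := pw k; rewrite /= /tree_trans; case: ifP; rewrite ?ltxx // => + _.
  by case/orP => /eqP->; [exists false|exists true].
exists (rcons u b); first by rewrite size_rcons uk.
move=> i; rewrite size_rcons leq_eqVlt => /predU1P[->|].
  rewrite uk wk -cats1 -[in RHS]cats1 take_oversize ?size_cat ?uk ?addn1 // catA.
  by rewrite wu ?uk // -uk take_size.
rewrite ltnS => iu; rewrite wu // -cats1 takel_cat //.
Qed.

Lemma through_tree_is_path n (w : nat -> seq bool) :
  (forall k, exists2 u, (k <= size u)%N & through n u w) ->
  w 0%N = n /\ is_path (M := T) w.
Proof.
move=> H; split; first by have [u _ wu] := H 0%N; rewrite wu // take0 cats0.
move=> i; have [u iu wu] := H i.+1.
rewrite /= /tree_trans (wu _ iu) (wu _ (ltnW iu)) (take_nth false iu) -rcons_cat.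
by case: (nth _ _ _); rewrite eqxx ?orbT invr_gt0.
Qed.

End tree_measure.

(** * Words of tosses with a prescribed visible trace *)

Section hits.
Variables (Y : Type) (st : seq bool -> option Y).
Implicit Types (n : seq bool) (u v : seq bool) (ys : seq Y).

(** [scanl] omits its starting value, so the node [n] itself does not contribute. *)
Definition trace n u := pmap st (scanl rcons n u).

(* Requiring a nonempty word to end at a visible node makes [hits n ys]
   prefix-free. *)
Definition hits n ys : set (seq bool) :=
  [set u | trace n u = ys /\ (u = [::] \/ st (n ++ u))].

Lemma trace_cat n u v : trace n (u ++ v) = trace n u ++ trace (n ++ u) v.
Proof. by rewrite /trace scanl_cat pmap_cat foldl_rcons_cat. Qed.

Lemma hits_cat n u v ys zs :
  hits n ys u -> hits (n ++ u) zs v -> hits n (ys ++ zs) (u ++ v).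
Proof.
move=> [tu lu] [tv lv]; split; first by rewrite trace_cat tu tv.
by case: lv => [->|]; rewrite ?cats0 ?catA //; right.
Qed.

Lemma hits_nil n : hits n [::] = [set [::]].
Proof.
apply/seteqP; split=> u; last by move=> ->; split=> //; left.
case/lastP: u => // u b [+ [/(congr1 size)|]]; first by rewrite size_rcons.
rewrite /trace scanl_rcons -cats1 pmap_cat foldl_rcons_cat /=.
by case: (st (n ++ rcons u b)) => //= x /(congr1 size); rewrite size_cat addn1.
Qed.

Lemma hits_last n ys y u : hits n (rcons ys y) u -> st (n ++ u) = Some y.
Proof.
case/lastP: u => [[/(congr1 size)]|u b [+ [/(congr1 size)|]]]; rewrite ?size_rcons //.
rewrite /trace scanl_rcons -cats1 pmap_cat foldl_rcons_cat /=.
by case: (st (n ++ rcons u b)) => //= x; rewrite cats1 => /rcons_inj[_ ->].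
Qed.

Lemma prefix_free_hits n ys : prefix_free (hits n ys).
Proof.
move=> u v [tu _] [+ luv]; rewrite trace_cat tu => /(congr1 size).
rewrite size_cat -[X in _ = X]addn0 => /addnI /size0nil tv.
suff : hits (n ++ u) [::] v by rewrite hits_nil.
split=> //; case: v luv {tv} => [|b v]; first by left.
by case=> [/(congr1 size)|]; [rewrite size_cat addnS|rewrite catA; right].
Qed.

Lemma hits_cons n b y ys u :
  hits n (y :: ys) (b :: u) <->
  if st (rcons n b) is Some x then x = y /\ hits (rcons n b) ys u
  else hits (rcons n b) (y :: ys) u.
Proof.
rewrite /hits /trace /= -cat_rcons; case E: (st (rcons n b)) => [x|] /=.
  split=> [[[xy tu] [//|lu]]|[-> [-> lu]]]; split=> //; first by split=> //; right.
  by right; case: lu => [->|//]; rewrite cats0 E.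
split=> -[tu lu]; split=> //; first by case: lu => // lu; right.
by right; case: lu => // u0; rewrite u0 in tu.
Qed.

Lemma hits_split n y ys w : hits n (y :: ys) w ->
  exists u v, [/\ w = u ++ v, hits n [:: y] u & hits (n ++ u) ys v].
Proof.
elim: w n => [|b w IH] n; first by case.
move=> /hits_cons; case E: (st (rcons n b)) => [x|].
  move=> [xy hw]; exists [:: b], w; rewrite cats1; split=> //.
  by apply/hits_cons; rewrite E; split=> //; rewrite hits_nil.
move=> /IH[u [v [-> hu hv]]]; exists (b :: u), v; split=> //.
  by apply/hits_cons; rewrite E.
by rewrite -cat_rcons.
Qed.

(** A word is cut at its first visible node; the cut is unique because [hits n [:: y]] is
    prefix-free. *)
Lemma set_bij_hits n y ys :
  set_bij (hits n [:: y] `*`` (fun u => hits (n ++ u) ys)) (hits n (y :: ys))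
    (fun p => p.1 ++ p.2).
Proof.
split.
- by move=> [u v] [/= hu hv]; exact: (hits_cat hu hv).
- move=> [u v] [u' v'] /set_mem[/= hu hv] /set_mem[/= hu' hv'] e.
  suff uu' : u = u' by move: e; rewrite uu' => /eqP; rewrite eqseq_cat // eqxx => /eqP->.
  wlog uu' : u v u' v' hu hv hu' hv' e / (size u <= size u')%N.
    move=> H; case/orP: (leq_total (size u) (size u')) => h; first exact: H e h.
    by apply/esym; exact: (H _ _ _ _ hu' hv' hu hv (esym e) h).
  have e' : u = take (size u) u'.
    by have := congr1 (take (size u)) e; rewrite take_size_cat // takel_cat.
  have := @prefix_free_hits n [:: y] u (drop (size u) u').
  rewrite {2}e' cat_take_drop => /(_ hu hu') d0.
  by rewrite e' -[in RHS](cat_take_drop (size u) u') d0 cats0.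
- by move=> w /hits_split[u [v [-> hu hv]]]; exists (u, v).
Qed.

(** Combinatorial form of the strong Markov property at the first visible node. *)
Lemma weight_hits_cons (R : realType) n y ys :
  weight R (hits n (y :: ys)) =
  (\esum_(u in hits n [:: y]) ((2^-1 ^+ size u)%:E * weight R (hits (n ++ u) ys)))%E.
Proof.
rewrite /weight (reindex_esum _ _ _ _ (set_bij_hits n y ys)).
rewrite -(esum_esum (a := fun u v => (2^-1 ^+ size (u ++ v))%:E)); last first.
  by move=> u v _ _; rewrite lee_fin exprn_ge0.
apply: eq_esum => u _; rewrite -esumZl.
- by apply: eq_esum => v _; rewrite size_cat exprD EFinM.
- by rewrite exprn_ge0.
- by move=> v _; rewrite lee_fin exprn_ge0.
Qed.

Lemma weight_hits_nil (R : realType) n : weight R (hits n [::]) = 1%E.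
Proof. by rewrite hits_nil /weight esum_set1. Qed.

Section projection.
Variables (R : realType) (Sigma : Type) (t : seq bool -> Sigma) (y0 : Y).

Lemma through_trace n u (w : nat -> seq bool) : through n u w ->
  pmap st (mkseq (suffix w 1) (size u)) = trace n u.
Proof.
rewrite -cylinder_branch /cylinder /branch /= size_scanl mkseq_suffix => -[_ wu].
by rewrite wu.
Qed.

(** The branch is shifted by one because [hits] ignores the visibility of the starting node. *)
Lemma readout_hits n ys (w : nat -> seq bool) :
  w 0%N = n -> is_path (M := tree_chain R t) w -> visible st w ->
  (\bigcup_(u in hits n ys) through n u) w <->
  mkseq (readout st y0 (suffix w 1)) (size ys) = ys.
Proof.
move=> w0 pw vw; have vw1 := visible_suffix 1 vw; split.
  move=> [u [tu _] wu]; rewrite -tu -(through_trace wu).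
  exact: pmap_readout.
have [k pk lk] := readout_pmap y0 (size ys) vw1.
have [u uk wu] := tree_is_path w0 pw k.
move=> pys; exists u => //; split.
  by rewrite -(through_trace wu) uk pk.
move: lk; rewrite -uk; case: u uk wu => [|b u] uk wu; first by left.
move=> /= lk; right; have := wu (size (b :: u)) (leqnn _); rewrite take_size => <-.
exact: lk.
Qed.

End projection.

End hits.

Lemma weight_gt0 (R : realType) (A : set (seq bool)) :
  (0 < weight R A)%E <-> exists u, A u.
Proof.
split=> [|[u Au]].
  apply: contraPP => /forallNP A0; rewrite (_ : A = set0) ?/weight ?esum_set0 ?ltxx //.
  by apply/seteqP; split=> u // /A0.
apply: (@lt_le_trans _ _ (2^-1 ^+ size u)%:E); first by rewrite lte_fin exprn_gt0.
rewrite -(@esum_set1 R _ u (fun u => (2^-1 ^+ size u)%:E)) ?lee_fin ?exprn_ge0 //.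
rewrite /weight esum_mkcond [leRHS]esum_mkcond; apply: le_esum => v _.
case: ifPn => [|_]; first by rewrite inE => ->; rewrite mem_set.
by case: ifP => // _; rewrite lee_fin exprn_ge0.
Qed.

Lemma esum_trivIset_bigcup (R : realType) (I T : choiceType) (K : set I)
    (J : I -> set T) (a : T -> \bar R) :
  trivIset K J -> (forall x, 0 <= a x)%E ->
  (\esum_(i in \bigcup_(k in K) J k) a i = \esum_(k in K) \esum_(i in J k) a i)%E.
Proof.
move=> tJ a0; rewrite esum_esum //; apply: reindex_esum; split.
- by move=> [k i] /= [Kk Ji]; exists k.
- move=> [k i] [k' i'] /set_mem[/= Kk Ji] /set_mem[/= Kk' Ji'] ii'.
  by rewrite -ii' in Ji' *; rewrite (tJ k k') //; exists i.
- by move=> i [k Kk Ji]; exists (k, i).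
Qed.

(** * Almost sure recurrence of visible nodes *)

Section almost_surely_visible.
Variables (R : realType) (Sigma : Type) (t : seq bool -> Sigma).
Variables (st : seq bool -> option unit) (D : set (seq bool)).
Let T := tree_chain R t.
Hypothesis D_cat : forall n u, D n -> D (n ++ u).
Hypothesis one_hit : forall n, D n -> st n -> weight R (hits st n [:: tt]) = 1%E.

Lemma weight_hits_nseq n k : D n -> st n -> weight R (hits st n (nseq k tt)) = 1%E.
Proof.
elim: k n => [|k IH] n Dn sn; first by rewrite weight_hits_nil.
rewrite weight_hits_cons -[RHS](one_hit Dn sn); apply: eq_esum => u hu.
by rewrite IH ?mule1 //; [exact: D_cat|rewrite (@hits_last _ _ _ [::] tt)].
Qed.

(** Built from cylinders, hence measurable, this event entails both being a path and being visible,
    and its probability can be read off the weights. *)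
Definition keeps_hitting n : set (nat -> seq bool) :=
  \bigcap_k \bigcup_(u in hits st n (nseq k tt)) through n u.

Lemma measurable_keeps_hitting n :
  measurable (keeps_hitting n : set (path_space (n : T))).
Proof. by apply: bigcapT_measurable => k; exact: measurable_bigcup_through. Qed.

Lemma path_measure_keeps_hitting n : D n -> st n ->
  path_measure (n : T) (keeps_hitting n) = 1%E.
Proof.
move=> Dn sn; apply: probability_bigcap => k.
  exact: measurable_bigcup_through.
by rewrite path_measure_bigcup_through ?weight_hits_nseq //; exact: prefix_free_hits.
Qed.

Lemma keeps_hittingP n w : keeps_hitting n w ->
  [/\ w 0%N = n, is_path (M := T) w & visible st w].
Proof.
move=> Hw.
(* Every visible node reached takes at least one toss, so the words met are unboundedly long and
   determine the whole branch. *)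
have szu k u : hits st n (nseq k tt) u -> (k <= size u)%N.
  move=> [/(congr1 size) + _]; rewrite size_nseq => <-.
  by rewrite size_pmap (leq_trans (count_size _ _)) // size_scanl.
have [k|w0 pw] := @through_tree_is_path R _ t n w.
  by have [u /szu ku wu] := Hw k I; exists u.
split=> // i; have [u hu wu] := Hw i.+1 I.
have iu := szu _ _ hu; exists (size u - i)%N; rewrite subnKC; last exact: ltnW.
by rewrite wu // take_size; case: hu => _ [u0|//]; rewrite u0 in iu.
Qed.

End almost_surely_visible.

Section seen.
Variables (Y : choiceType) (st : seq bool -> option Y).

(** Forgetting which state is shown turns reaching any visible node into the single trace
    [[:: tt]]. *)
Definition seen n : option unit := omap (fun=> tt) (st n).

Lemma visible_seen w : visible seen w <-> visible st w.
Proof. by split=> vw i; have [j] := vw i; rewrite /seen => h; exists j; move: h; case: (st _). Qed.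

(** The first visible node shows exactly one state, so the events for distinct states are
    disjoint. *)
Lemma weight_hits_seen (R : realType) n :
  weight R (hits seen n [:: tt]) = (\esum_(y in [set: Y]) weight R (hits st n [:: y]))%E.
Proof.
have trace_seen u : trace seen n u = nseq (size (trace st n u)) tt.
  by rewrite /trace /seen; elim: (scanl _ _ _) => //= m s IH; case: (st m) => //= y; rewrite IH.
have -> : hits seen n [:: tt] = \bigcup_y hits st n [:: y].
  apply/seteqP; split=> u.
    move=> [+ lu]; rewrite trace_seen.
    case E: (trace st n u) => [|y [|]] //= _; exists y => //; split=> //.
    by case: lu => [->|]; [left|rewrite /seen; case: (st _); right].
  move=> [y _ [tu lu]]; split; first by rewrite trace_seen tu.
  by case: lu => [->|]; [left|rewrite /seen; case: (st _); right].
rewrite /weight esum_trivIset_bigcup //.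
by move=> y z _ _ [u [[tu _] [tu' _]]]; move: tu'; rewrite tu => -[].
Qed.

End seen.

(** * Satisfaction in a chain and in a tree simulating it *)

Section correspondence.
Variables (R : realType) (Sigma : Type) (M : markov_chain R Sigma).
Variables (t : seq bool -> option Sigma) (st : seq bool -> option M).
Variables (D : set (seq bool)) (y0 : M).
Let T := tree_chain R t.
(** [D] is a union of subtrees: the whole tree for the simulation by tosses, but only the part below
    the given node for the first-return chain. *)
Hypothesis D_cat : forall n u, D n -> D (n ++ u).
Hypothesis st_label : forall n, D n -> t n = omap (mc_label M) (st n).
Hypothesis st_trans : forall n x y, D n -> st n = Some x ->
  weight R (hits st n [:: y]) = (mc_trans M x y)%:E.

Local Notation readout := (readout st y0).

Lemma weight_hits n x ys : D n -> st n = Some x ->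
  weight R (hits st n ys) = (word_weight x ys)%:E.
Proof.
elim: ys n x => [|y ys IH] n x Dn sx; first by rewrite weight_hits_nil.
rewrite weight_hits_cons /= mulrC EFinM -(st_trans y Dn sx) -esumZl.
- apply: eq_esum => u hu; rewrite muleC (IH _ y) //; first exact: D_cat.
  exact: (hits_last (ys := [::])).
- exact: word_weight_ge0.
- by move=> u _; rewrite lee_fin exprn_ge0.
Qed.

Local Notation seen := (seen st).

Lemma one_hit_seen n : D n -> seen n -> weight R (hits seen n [:: tt]) = 1%E.
Proof.
rewrite {1}/seen; case sx: (st n) => [x|//] Dn _.
rewrite weight_hits_seen -(mc_trans_sum1 x).
by apply: eq_esum => y _; exact: st_trans.
Qed.

(* The projection of the path measure of the tree has the cylinder weights of
   [M], hence is the path measure of [M]. *)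
Lemma path_measure_readout n x (A : set (path_space x))
    (B : set (path_space (n : T))) :
  D n -> st n = Some x -> measurable A -> measurable B ->
  (forall w, w 0%N = n -> is_path (M := T) w -> visible st w ->
     A (readout w) <-> B w) ->
  path_measure x A = path_measure (n : T) B.
Proof.
move=> Dn sx mA mB AB; pose P := path_measure (n : T).
have sn : seen n by rewrite /seen sx.
pose H : set (path_space (n : T)) := keeps_hitting seen n.
have mH : measurable H by exact: measurable_keeps_hitting.
have H1 : P H = 1%E := path_measure_keeps_hitting t D_cat one_hit_seen Dn sn.
have HP w : H w -> [/\ w 0%N = n, is_path (M := T) w & visible st w].
  by move=> /(@keeps_hittingP R _ t)[w0 pw /visible_seen vw].
(* Off the almost sure event [H] the readout is replaced by a constant sequence, so that [X] is
   measurable on the whole space. *)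
pose X (w : path_space (n : T)) : path_space x :=
  if `[< H w >] then readout w else fun=> x.
have XH w : H w -> X w = readout w by move=> Hw; rewrite /X asboolT.
(* The counterpart in the tree of a cylinder of [M]: the first letter is the state shown at [n], and
   only the remaining ones are traced by [hits]. *)
pose C (v : seq M) : set (path_space (n : T)) :=
  if v is z :: ys then
    if z == x then \bigcup_(u in hits st n ys) through n u else set0
  else setT.
have mC v : measurable (C v).
  by case: v => [|z ys] //=; case: ifP => // _; exact: measurable_bigcup_through.
have XC v w : H w -> cylinder v (X w) <-> C v w.
  move=> Hw; rewrite XH //; have [w0 pw vw] := HP w Hw; case: v => [|z ys] //=.
  have sw0 : st (w 0%N) = Some x by rewrite w0.
  have [r0 r1] := readout_some y0 vw sw0.
  rewrite /cylinder /mkset [size _]/= mkseq_suffix r0 r1.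
  have := @readout_hits _ st R _ t y0 n ys w w0 pw vw; case: eqVneq => [->|zx] [h1 h2].
    by split=> [[/h2//]|/h1->].
  by split=> // -[/esym/eqP]; rewrite (negbTE zx).
have mX : measurable_fun setT X.
  apply: (@measurability _ _ _ (path_space x) setT X (@cylinders M)) => //.
  move=> _ [_ [v _ <-] <-]; rewrite setTI.
  rewrite (_ : _ @^-1` _ = (H `&` C v) `|`
      (~` H `&` if `[< cylinder v (fun=> x) >] then setT else set0)).
    apply: measurableU; first exact: measurableI.
    by apply: measurableI; [exact: measurableC|case: ifP].
  apply/seteqP; split=> w /=.
    have [Hw /(XC v w Hw)|nHw] := pselect (H w); first by left.
    by rewrite /X asboolF // => xv; right; split=> //; rewrite asboolT.
  move=> [[Hw /(XC v w Hw)//]|[nHw]]; case: asboolP => // xv _.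
  by rewrite /X asboolF.

pose XM := isMeasurableFun.Build _ _ _ _ X mX.
pose Xf : {mfun path_space (n : T) >-> path_space x} := HB.pack X XM.
have nuE : is_path_measure (distribution P Xf).
  move=> v; transitivity (P (X @^-1` cylinder v)); first by [].
  transitivity (P (C v)).
    apply: (probability_eq mH) => //; last exact: XC.
    by rewrite -[X in measurable X]setTI; exact: (mX measurableT _ (measurable_cylinder _)).
  case: v => [|z ys]; first exact: probability_setT.
  rewrite /C /cylinder_weight; case: eqVneq => [->|_]; last first.
    by rewrite mul0r; exact: measure0.
  transitivity (weight R (hits st n ys)).
    by apply: path_measure_bigcup_through; exact: prefix_free_hits.
  by rewrite (weight_hits ys Dn sx) mul1r.
rewrite (path_measure_unique (path_measureE x) nuE mA).
apply: (probability_eq mH) => //.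
  by rewrite -[X in measurable X]setTI; exact: (mX measurableT _ mA).
by move=> w Hw; rewrite /preimage /= XH //; have [] := HP w Hw; exact: AB.
Qed.

(** The branch itself supplies a word between consecutive visible nodes, and a nonempty set of words
    has positive weight. *)
Lemma readout_is_path w : D (w 0%N) -> is_path (M := T) w -> visible st w ->
  is_path (M := M) (readout w).
Proof.
move=> + pw vw k.
have suf_path v i : is_path (M := T) v -> is_path (M := T) (suffix v i).
  by move=> pv j; rewrite /suffix addnS; exact: pv.
have Dw v : D (v 0%N) -> is_path (M := T) v -> forall i, D (v i).
  move=> Dv pv i; have [u uk ->] := tree_is_path (erefl _) pv i; last by rewrite uk.
  exact: D_cat.
elim: k w pw vw => [|k IH] w pw vw D0; last first.
  have [_ r1] := readout_first y0 vw.
  have := IH (after_visible st w) (suf_path _ _ pw) (visible_suffix _ vw).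
  by rewrite -r1 /suffix !add1n; apply; exact: (Dw w D0 pw).
have [sw r1] := readout_first y0 vw; move: r1; rewrite /after_visible.
set m := first_visible st w in sw * => r1.
have -> : readout w 1%N = readout (suffix w m.+1) 0%N by rewrite -r1.
have pm := suf_path w m pw; have vm := visible_suffix m vw.
have w0 : suffix w m 0%N = w m by rewrite /suffix addn0.
have [_ [|u hu _]] := readout_hits y0 [:: readout (suffix w m.+1) 0%N] w0 pm vm.
  by rewrite suffix_add addn1.
rewrite -lte_fin -(st_trans _ (Dw _ D0 pw m) sw); apply/weight_gt0.
by exists u.
Qed.

(** A positive transition has positive weight, hence some word of tosses realises it; the chosen
    words are concatenated into a branch. *)
Lemma readout_lift n x z : D n -> st n = Some x -> z 0%N = x ->
  is_path (M := M) z ->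
  exists w, [/\ w 0%N = n, is_path (M := T) w, visible st w & readout w = z].
Proof.
move=> Dn sx z0 pz.
(* Stated as an implication, the choice is total, so the words [U k] can be defined before they are
   known to end at the right state. *)
have next u k : exists v, st (n ++ u) = Some (z k) -> hits st (n ++ u) [:: z k.+1] v.
  have [su|su] := pselect (st (n ++ u) = Some (z k)); last by exists [::].
  have /weight_gt0[v hv] : (0 < weight R (hits st (n ++ u) [:: z k.+1]))%E.
    by rewrite (st_trans _ (D_cat _ Dn) su) lte_fin; exact: pz.
  by exists v.
pose U := fix U k := if k is k'.+1 then U k' ++ projT1 (cid (next (U k') k')) else [::].
have UP k : st (n ++ U k) = Some (z k) /\ hits st n (mkseq (suffix z 1) k) (U k).
  elim: k => [|k [sk hk]] /=; first by rewrite cats0 sx z0 hits_nil.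
  case: cid => v /= /(_ sk) hv; split; first by rewrite catA; exact: (hits_last (ys := [::])).
  by rewrite mkseqS -cats1; exact: hits_cat.
have szU k : (k <= size (U k))%N.
  have [_ [/(congr1 size) + _]] := UP k; rewrite size_mkseq => {1}<-.
  by rewrite size_pmap (leq_trans (count_size _ _)) // size_scanl.
have prefU i j : exists r, U (i + j)%N = U i ++ r.
  elim: j => [|j [r e]]; first by exists [::]; rewrite addn0 cats0.
  by rewrite addnS /= e -catA; eexists.
(* [U i] has at least [i] letters, so this prefix agrees with those of all later words. *)
pose w i := n ++ take i (U i).
have wU k : through n (U k) w.
  move=> i ik; rewrite /w; congr (_ ++ _); case/orP: (leq_total i k) => h.
    by have [r] := prefU i (k - i)%N; rewrite subnKC // => ->; rewrite takel_cat.
  by have [r] := prefU k (i - k)%N; rewrite subnKC // => ->; rewrite takel_cat.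
have [k|w0 pw] := @through_tree_is_path R _ t n w; first by exists (U k).
have vw : visible st w.
  move=> i; exists (size (U i) - i)%N; rewrite subnKC //.
  by rewrite (wU i) // take_size (UP i).1.
exists w; split=> //.
have [|r0 r1] := @readout_some _ _ st y0 w x vw; first by rewrite w0.
apply/funext => -[|k]; first by rewrite r0.
have /(congr1 (fun s => nth x s k)) :
    mkseq (readout (suffix w 1)) k.+1 = mkseq (suffix z 1) k.+1.
  rewrite -[k.+1 in LHS](size_mkseq (suffix z 1)).
  by apply/(readout_hits y0 _ w0 pw vw); exists (U k.+1) => //; exact: (UP k.+1).2.
by rewrite !nth_mkseq // -r1 /suffix add1n.
Qed.

Let V w := (forall i, D (w i)) /\ visible st w.

Let V_visible w : V w -> visible st w. Proof. by case. Qed.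

Let V_suffix w k : V w -> V (suffix w k).
Proof. by move=> [Dw vw]; split; [move=> i; exact: Dw|exact: visible_suffix]. Qed.

Lemma circ_label n : D n -> t n = None <-> st n = None.
Proof. by move=> /st_label->; case: (st n). Qed.

Lemma after_circ_sat w chi : V w ->
  path_sat (M := T) w (after_circ chi) <->
  path_sat (M := T) (suffix w (first_visible st w)) chi.
Proof.
move=> [Dw vw]; have [sm mm] := first_visibleP vw.
have cw i : t (suffix w i 0%N) = None <-> st (w i) = None.
  by rewrite /suffix addn0; exact: circ_label.
split=> /=.
  move=> [m [[tm cm] bm]].
  suff -> : first_visible st w = m by [].
  apply: first_visible_uniq => //; last by move=> i /bm /cw.
  by case E: (st (w m)) => //; case: tm; apply/cw.
move=> cm; exists (first_visible st w); split; last by move=> i /mm /cw.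
by split=> // /cw s0; rewrite s0 in sm.
Qed.

Lemma infinitely_visible_sat w : (forall i, D (w i)) ->
  path_sat (M := T) w (infinitely_visible Sigma) <-> visible st w.
Proof.
move=> Dw; have cw i j : t (suffix (suffix w i) j 0%N) = None <-> st (w (i + j)%N) = None.
  by rewrite /suffix addn0; exact: circ_label.
split=> /= H i; have [j] := H i.
  by move=> [+ _] => tj; exists j; case E: (st _) => //; case: tj; apply/cw.
by move=> sj; exists j; split=> // /cw s0; rewrite s0 in sj.
Qed.

Lemma infinitely_visible_as n x : D n -> st n = Some x ->
  path_measure (n : T) [set w | path_sat (M := T) w (infinitely_visible Sigma)] = 1%E.
Proof.
move=> Dn sx; have sn : seen n by rewrite /seen sx.
transitivity (path_measure (n : T) setT); last exact: probability_setT.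
pose H : set (path_space (n : T)) := keeps_hitting seen n.
apply: (@probability_eq _ _ _ _ H) => //.
- exact: measurable_keeps_hitting.
- exact: measurable_path_sat.
- exact: (path_measure_keeps_hitting t D_cat one_hit_seen).
move=> w /(@keeps_hittingP R _ t)[w0 pw /visible_seen vw]; split=> // _.
apply/infinitely_visible_sat => // i.
by have [u ui ->] := tree_is_path w0 pw i; [exact: D_cat|rewrite ui].
Qed.

(** State formulas are compared at visible nodes only, but path formulas from every position of a
    visible branch, as [readout_until] and [readout_globally] require. *)
Lemma tr_sat :
  (forall phi n x, D n -> st n = Some x ->
     state_sat (M := M) x phi <-> state_sat (M := T) n (tr_state phi)) /\
  (forall psi w, V w ->
     path_sat (M := M) (readout w) psi <-> path_sat (M := T) w (tr_path psi)).
Proof.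
have tree_D n w : D n -> w 0%N = n -> is_path (M := T) w -> forall i, D (w i).
  move=> Dn w0 pw i; have [u ui ->] := tree_is_path w0 pw i; last by rewrite ui.
  exact: D_cat.
have prob psi : (forall w, V w ->
     path_sat (M := M) (readout w) psi <-> path_sat (M := T) w (tr_path psi)) ->
   forall n x, D n -> st n = Some x ->
   path_measure x [set w | path_sat w psi] =
   path_measure (n : T) [set w | path_sat (M := T) w (tr_path psi)].
  move=> IH n x Dn sx; apply: path_measure_readout => //; try exact: measurable_path_sat.
  by move=> w w0 pw vw; apply: IH; split=> //; exact: (tree_D n w).
apply: formula_ind => /=.
- by [].
- by [].
- move=> a n x Dn sx; rewrite st_label // sx /=.
  by split=> [->|[]].
- by move=> p IHp q IHq n x Dn sx; rewrite (IHp n x) // (IHq n x).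
- by move=> p IHp q IHq n x Dn sx; rewrite (IHp n x) // (IHq n x).
- by move=> p IHp n x Dn sx; rewrite (IHp n x).
- move=> psi IH n x Dn sx; split=> -[w [w0 pw]].
    have [w' [w'0 pw' vw' <-]] := readout_lift Dn sx w0 pw.
    have Dw' := tree_D _ _ Dn w'0 pw'.
    by move=> /(IH w' (conj Dw' vw')) ?; exists w'; split=> //; split=> //; apply/infinitely_visible_sat.
  have Dw := tree_D _ _ Dn w0 pw.
  move=> [/(infinitely_visible_sat Dw) vw /(IH w (conj Dw vw)) sw].
  exists (readout w); split=> //; last by apply: readout_is_path => //; exact: Dw.
  by have [|-> _] := @readout_some _ _ st y0 w x vw; first by rewrite w0.
- move=> psi IH n x Dn sx; split=> H w w0 pw.
    have Dw := tree_D _ _ Dn w0 pw.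
    (* A branch that is not visible infinitely often satisfies the left disjunct of the translated
       [SForall]. *)
    have [/(infinitely_visible_sat Dw) vw|] := pselect (path_sat (M := T) w (infinitely_visible Sigma)); last by left.
    right; apply/(IH w (conj Dw vw)); apply: H.
      by have [|-> _] := @readout_some _ _ st y0 w x vw; first by rewrite w0.
    by apply: readout_is_path => //; exact: Dw.
  have [w' [w'0 pw' vw' <-]] := readout_lift Dn sx w0 pw.
  have Dw' := tree_D _ _ Dn w'0 pw'.
  apply/(IH w' (conj Dw' vw')); case: (H w' w'0 pw') => // -[].
  exact/infinitely_visible_sat.
- by move=> psi IH n x Dn sx; rewrite (prob psi IH n x).
- by move=> psi IH n x Dn sx; rewrite (prob psi IH n x).
- move=> phi IH w Vw.
  apply: iff_trans (iff_sym (after_circ_sat (PState (tr_state phi)) Vw)) => /=.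
  have [sw _] := readout_first y0 Vw.2.
  by rewrite /suffix addn0; apply: IH => //; exact: Vw.1.
- by move=> psi IH w Vw; rewrite (IH w Vw).
- by move=> p IHp q IHq w Vw; rewrite (IHp w Vw) (IHq w Vw).
- by move=> p IHp q IHq w Vw; rewrite (IHp w Vw) (IHq w Vw).
- move=> psi IH w Vw.
  apply: iff_trans (iff_sym (after_circ_sat (PNext (tr_path psi)) Vw)) => /=.
  have [_ ->] := readout_first y0 Vw.2.
  by rewrite suffix_add addn1; apply: IH; exact: V_suffix.
- move=> p IHp q IHq w Vw; exact: (@readout_until _ _ st y0 V V_visible V_suffix
    (fun v => path_sat v p) (fun v => path_sat v q)
    (fun v => path_sat (M := T) v (tr_path p))
    (fun v => path_sat (M := T) v (tr_path q)) IHp IHq w Vw).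
- move=> psi IH w Vw; exact: (@readout_globally _ _ st y0 V V_visible V_suffix
    (fun v => path_sat v psi) (fun v => path_sat (M := T) v (tr_path psi)) IH w Vw).
Qed.

End correspondence.

(** * The first-return chain of a tree *)

Section almost_sure_paths.
Variables (R : realType) (Sigma : Type) (t : seq bool -> Sigma).
Let T := tree_chain R t.
Let everywhere (_ : seq bool) : option unit := Some tt.

Lemma weight_hits_everywhere n : weight R (hits everywhere n [:: tt]) = 1%E.
Proof.
have -> : hits everywhere n [:: tt] = \bigcup_b [set [:: b]].
  apply/seteqP; split=> u; last by move=> [b _ ->]; split=> //; right.
  by case: u => [[]|b [|b' u]] //; [exists b|case].
rewrite /weight esum_trivIset_bigcup.
- rewrite (eq_esum (b := fun=> (2^-1)%:E)); last by move=> b _; rewrite esum_set1 ?lee_fin.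
  rewrite (esumID [set true]) // !setTI (_ : ~` [set true] = [set false]); last first.
    by apply/seteqP; split=> -[] //= /(_ erefl).
  by rewrite !esum_set1 ?lee_fin // -EFinD -[2^-1]mul1r -splitr.
- by move=> b c _ _ [u [-> []]].
- by move=> u; rewrite lee_fin exprn_ge0.
Qed.

(** Instance of [keeps_hitting] in which every node counts as visible. *)
Lemma tree_almost_surely_path n : exists Pi : set (path_space (n : T)),
  [/\ measurable Pi, path_measure (n : T) Pi = 1%E &
      forall w, Pi w -> w 0%N = n /\ is_path (M := T) w].
Proof.
exists (keeps_hitting everywhere n); split.
- exact: measurable_keeps_hitting.
- apply: (@path_measure_keeps_hitting _ _ _ everywhere setT) => // m _ _.
  exact: weight_hits_everywhere.
- by move=> w /(@keeps_hittingP R _ t)[].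
Qed.

End almost_sure_paths.

Section first_return_chain.
Variables (R : realType) (Sigma : Type) (t : seq bool -> option Sigma).
Variable a0 : Sigma.
Let T := tree_chain R t.

(** The states of the chain are the nodes themselves, since nodes with equal labels may have
    different futures. *)
Definition visible_node (n : seq bool) : option (seq bool) :=
  if t n is Some _ then Some n else None.

Local Notation st := visible_node.

Definition return_weight (n m : seq bool) := weight R (hits st n [:: m]).

Lemma return_weight_fin n m : return_weight n m \is a fin_num.
Proof.
rewrite /return_weight.
have <- := @path_measure_bigcup_through R _ t n _ (@prefix_free_hits _ st n [:: m]).
by apply: fin_num_measure; exact: measurable_bigcup_through.
Qed.

Definition returning n :=
  `[< (\esum_(m in [set: seq bool]) return_weight n m = 1)%E >].

(* Nodes from which the first return is not almost sure get a loop, so that the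
   rows sum to 1; they are unreachable in the application. *)
Definition return_trans (n m : seq bool) : R :=
  if returning n then fine (return_weight n m) else (n == m)%:R.

Lemma return_trans_ge0 n m : 0 <= return_trans n m.
Proof.
rewrite /return_trans; case: ifP => // _; apply/fine_ge0/esum_ge0 => u _.
by rewrite lee_fin exprn_ge0.
Qed.

Lemma return_trans_sum1 n :
  (\esum_(m in [set: seq bool]) (return_trans n m)%:E = 1)%E.
Proof.
rewrite /return_trans; case: (boolP (returning n)) => [/asboolP rn|_].
  by rewrite -[RHS]rn; apply: eq_esum => m _; rewrite fineK // return_weight_fin.
rewrite (esumID [set n]); last by move=> m _; rewrite lee_fin.
rewrite setTI esum_set1 ?lee_fin // eqxx [X in (_ + X)%E]esum1 ?adde0 //.
by move=> m [_ /= nm]; rewrite (_ : (n == m) = false) //; apply/eqP => /esym.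
Qed.

(** Invisible nodes are states too, with the dummy label [a0]; the return weight to such a node is
    zero. *)
Definition return_chain : markov_chain R Sigma :=
  @MarkovChain R Sigma (seq bool) return_trans (fun n => odflt a0 (t n))
    return_trans_ge0 return_trans_sum1.

Lemma visible_node_label n : t n = omap (mc_label return_chain) (st n).
Proof. by rewrite /st /=; case E: (t n) => [a|] //=; rewrite E. Qed.

Variable root : seq bool.

Definition below : set (seq bool) := [set n | exists u, n = root ++ u].

Lemma below_cat n u : below n -> below (n ++ u).
Proof. by move=> [v ->]; exists (v ++ u); rewrite catA. Qed.

Hypothesis visible_as : path_measure (root : T)
  [set w | path_sat (M := T) w (infinitely_visible Sigma)] = 1%E.

(** A branch from the root passes through [n] with positive probability and then almost surely shows
    a visible node strictly later. Comparing the two probabilities and cancelling that of reaching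
    [n] gives a return of weight one. *)
Lemma returning_below n : below n -> returning n.
Proof.
move=> [v nE]; apply/asboolP; rewrite -weight_hits_seen.
set h := hits (seen st) n [:: tt].
pose A := [set v ++ u | u in h].
have inj_v : set_inj h (fun u => v ++ u).
  by move=> u u' _ _ /eqP; rewrite eqseq_cat // eqxx => /eqP.
have pA : prefix_free A.
  move=> _ u [r hr <-] [r' hr'] /eqP; rewrite -catA eqseq_cat // eqxx => /eqP r'E.
  by rewrite r'E in hr'; exact: (prefix_free_hits hr hr').
have pv : prefix_free [set v].
  by move=> _ u -> /= /(congr1 size); rewrite size_cat -[RHS]addn0 => /addnI /size0nil.
have wA : weight R A = ((2^-1 ^+ size v)%:E * weight R h)%E.
  rewrite /weight /A esum_image // -esumZl ?exprn_ge0 //.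
  by apply: eq_esum => u _; rewrite size_cat exprD EFinM.
have [Pi [mPi Pi1 PiP]] := @tree_almost_surely_path R _ t root.
have mV := @measurable_path_sat R _ T root (infinitely_visible Sigma).
have PVI : path_measure (root : T) (Pi `&`
    [set w | path_sat (M := T) w (infinitely_visible Sigma)]) = 1%E.
  rewrite -Pi1; apply: (probability_eq mV) => //; first exact: measurableI.
  by move=> w Vw; split=> [[]|].
have : path_measure (root : T) (\bigcup_(u in A) through root u) =
       path_measure (root : T) (\bigcup_(u in [set v]) through root u).
  apply: (probability_eq (measurableI _ _ mPi mV)) => //;
    try exact: measurable_bigcup_through.
  move=> w [/PiP[w0 pw] Vw]; split.
    move=> [_ [u hu <-] wu]; exists v => // i iv.
    by rewrite wu ?takel_cat // size_cat (leq_trans iv) // leq_addr.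
  move=> [_ -> wv].
  have {}Vw : visible st w.
    apply/(@infinitely_visible_sat R _ return_chain t st setT) => //.
    by move=> m _; exact: visible_node_label.
  have wn : suffix w (size v) 0%N = n.
    by rewrite /suffix addn0 wv // take_size nE.
  have pwn : is_path (M := T) (suffix w (size v)).
    by move=> i; rewrite /suffix addnS; exact: pw.
  have vwn : visible (seen st) (suffix w (size v)).
    by apply/visible_seen; exact: visible_suffix.
  have [_ [|u hu wu]] := @readout_hits _ (seen st) R _ t tt n [:: tt] _ wn pwn vwn.
    by congr (_ :: _); case: (X in X = tt).
  exists (v ++ u); first by exists u.
  move=> i; rewrite size_cat => ivu; have [iv|vi] := leqP i (size v).
    by rewrite wv // takel_cat.
  rewrite take_cat ltnNge (ltnW vi) /= catA -nE -wu ?leq_subLR //.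
  by rewrite /suffix subnKC // ltnW.
rewrite !path_measure_bigcup_through // wA {2}/weight esum_set1 ?lee_fin ?exprn_ge0 //.
move=> e; have c0 : (2^-1 : R) ^+ size v != 0 by rewrite expf_neq0 ?invr_eq0.
by rewrite -[LHS]mul1e -(mulVf c0) EFinM -muleA e -EFinM mulVf.
Qed.

Lemma visible_node_trans n x y : below n -> st n = Some x ->
  weight R (hits st n [:: y]) = (mc_trans return_chain x y)%:E.
Proof.
move=> bn; rewrite {1}/st; case: (t n) => // _ [<-] /=.
rewrite /return_trans returning_below // fineK //.
exact: return_weight_fin.
Qed.

End first_return_chain.

Lemma bin_sat_mc_sat (R : realType) (Sigma : Type) (phi : state_formula Sigma) :
  BIN_SAT R (bin_formula phi) -> MC_SAT R phi.
Proof.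
move=> [t [n [[/= tn pn] sn]]].
(* The conjunct [SNot circ] provides the label [a] of [n], which also serves as the default label of
   the chain. *)
case E: (t n) tn => [a|] tn; last by case: tn.
exists (return_chain R t a), n.
have [tr _] := @tr_sat R Sigma (return_chain R t a) t (visible_node t) (below n) n
  (@below_cat n) (fun m _ => visible_node_label R t a m)
  (@visible_node_trans R Sigma t a n pn).
apply/(tr phi n n) => //; first by exists [::]; rewrite cats0.
by rewrite /visible_node E.
Qed.

(** * Simulating a chain by coin tosses *)

Section dyadic.
Variable R : realType.
Implicit Types (u : R) (v : seq bool).

Fixpoint dyadic_lo v : R :=
  if v is b :: v' then (b%:R + dyadic_lo v') / 2 else 0.

Definition dyadic v : set R := `[dyadic_lo v, dyadic_lo v + 2^-1 ^+ size v[.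

Fixpoint bits u n : seq bool :=
  if n is n'.+1 then (1 <= 2 * u) :: bits (2 * u - (1 <= 2 * u)%R%:R) n' else [::].

Lemma size_bits u n : size (bits u n) = n.
Proof. by elim: n u => //= n IH u; rewrite IH. Qed.

Lemma take_bits u m n : (m <= n)%N -> take m (bits u n) = bits u m.
Proof. by elim: n m u => [|n IH] [|m] u //= mn; rewrite IH. Qed.

Lemma dyadicP v u : dyadic v u <-> 0 <= u < 1 /\ bits u (size v) = v.
Proof.
rewrite /dyadic /= in_itv /=; elim: v u => [|b v IH] u /=.
  by rewrite add0r expr0; split=> [|[]].
have := IH (2 * u - b%:R); rewrite exprS.
set l := dyadic_lo v; set e := 2^-1 ^+ size v => {}IH.
(* Doubling and removing the first digit maps the interval of [b :: v] onto that of [v]. *)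
have -> : ((b%:R + l) / 2 <= u < (b%:R + l) / 2 + 2^-1 * e) =
          (l <= 2 * u - b%:R < l + e).
  by apply/andP/andP => -[h1 h2]; split; lra.
split=> [/IH[h ebits]|[u01 [bE]]].
  have bu : (1 <= 2 * u) = b by case: b h {ebits IH} => /= h; apply/idP/idP => //; lra.
  by rewrite bu ebits; split=> //; case: b h {bu ebits IH} => /= h; lra.
rewrite bE => ebits; apply/IH; split=> //.
by case: b bE {ebits IH} => [|/negbT] /= h; lra.
Qed.

(** Tosses are traded for a uniform number: words whose intervals share a point are prefixes of one
    expansion, so a prefix-free set gives disjoint intervals. *)
Lemma weight_dyadic (A : set (seq bool)) : prefix_free A ->
  weight R A = lebesgue_measure (\bigcup_(v in A) dyadic v).
Proof.
move=> pA; rewrite measure_countable_bigcup.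
- apply: eq_esum => v _; transitivity (lebesgue_measure (dyadic v)); last by [].
  rewrite /dyadic lebesgue_measure_itv /= lte_fin ltrDl exprn_gt0 //.
  by rewrite -EFinB addrAC subrr add0r.
- by move=> v _; exact: measurable_itv.
move=> v v'; wlog vv' : v v' / (size v <= size v')%N.
  move=> H Av Av' [u [uv uv']]; case/orP: (leq_total (size v) (size v')) => h.
    by apply: H => //; exists u.
  by apply/esym; apply: H => //; exists u.
move=> Av Av' [u [/dyadicP[_ uv] /dyadicP[_ uv']]].
have e : v = take (size v) v' by rewrite -uv' take_bits // uv.
have := pA v (drop (size v) v'); rewrite {2}e cat_take_drop => /(_ Av Av') d0.
by rewrite e -[in RHS](cat_take_drop (size v) v') d0 cats0.
Qed.

Lemma small_dyadic (e : R) : 0 < e -> exists2 n, (0 < n)%N & 2^-1 ^+ n < e.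
Proof.
move=> e0; pose n := (Num.bound (e^-1)).+1.
exists n => //; rewrite exprVn invf_plt ?posrE ?exprn_gt0 //.
apply: (lt_le_trans (archi_boundP _)); first by rewrite invr_ge0 ltW.
by rewrite -natrX ler_nat ltnW // (ltn_trans _ (ltn_expl _ _)).
Qed.

End dyadic.

(** * Sampling a countable distribution by fair tosses *)

Section sampler.
Variables (R : realType) (S : countType) (p : S -> R).
Hypothesis p_ge0 : forall y, 0 <= p y.
Hypothesis p_sum1 : (\esum_(y in [set: S]) (p y)%:E = 1)%E.
Implicit Types (u : R) (v : seq bool) (y : S).

Let q n : R := if @pickle_inv S n is Some y then p y else 0.
Let F n : R := \sum_(0 <= i < n) q i.

Let q_ge0 n : 0 <= q n.
Proof. by rewrite /q; case: pickle_inv. Qed.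

Let F_le m n : (m <= n)%N -> F m <= F n.
Proof. by move=> mn; rewrite /F (big_cat_nat _ mn) //= lerDl sumr_ge0. Qed.

Let F_le1 n : F n <= 1.
Proof.
rewrite -lee_fin -p_sum1 /F esum_nneseries; last by move=> y _; rewrite lee_fin.
rewrite -sumEFin; apply: le_trans (nneseries_lim_ge n _); last first.
  by move=> k _; case: pickle_inv => // y; rewrite lee_fin.
rewrite [leRHS]big_mkcond; apply: lee_sum => k _ /=.
rewrite /q; case: ifPn; case E: (pickle_inv k) => [y|//]; rewrite ?lee_fin //.
rewrite notin_setE => -[]; exists y => //.
by have := @pickle_invK S k; rewrite /oapp E.
Qed.

Let lo y := F (pickle y).
Let hi y := F (pickle y).+1.

Let hiE y : hi y = lo y + p y.
Proof. by rewrite /hi /lo /F big_nat_recr //= /q pickleK_inv. Qed.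

Let cell_uniq u y y' : lo y <= u < hi y -> lo y' <= u < hi y' -> y = y'.
Proof.
wlog yy' : y y' / (pickle y < pickle y')%N.
  move=> H h h'; case: (ltngtP (pickle y) (pickle y')) => [yy'|yy'|].
  - exact: H.
  - by apply/esym; exact: H.
  - exact: (pcan_inj (@pickleK S)).
move=> /andP[_ h1] /andP[h2 _]; exfalso.
by have := F_le yy'; rewrite leNgt (le_lt_trans h2 h1).
Qed.

Let inside v y := lo y <= dyadic_lo R v /\ dyadic_lo R v + 2^-1 ^+ size v <= hi y.

Definition sample v : option S :=
  if pselect (exists y, inside v y) is left e then Some (projT1 (cid e)) else None.

Let sampleP v y : sample v = Some y <-> inside v y.
Proof.
have uniq z z' : inside v z -> inside v z' -> z = z'.
  have v0 : 0 < 2^-1 ^+ size v :> R by rewrite exprn_gt0.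
  move=> [h1 h2] [h1' h2']; apply: (@cell_uniq (dyadic_lo R v)).
    by rewrite h1 (lt_le_trans _ h2) // ltrDl.
  by rewrite h1' (lt_le_trans _ h2') // ltrDl.
rewrite /sample; case: pselect => [e|ne]; last by split=> // vy; case: ne; exists y.
by case: cid => z vz /=; split=> [[<-]//|vy]; congr Some; exact: uniq.
Qed.

(** The empty word is never tested: even a state of probability one costs a toss, so that every
    choice moves down the tree. *)
Definition first_sample y : set (seq bool) :=
  [set v | [/\ v != [::], sample v = Some y &
     forall k, (0 < k < size v)%N -> sample (take k v) = None]].

Lemma prefix_free_first_sample y : prefix_free (first_sample y).
Proof.
move=> v v' [v0 vy _] [_ _ vv']; apply/eqP; apply: contraPT vy => v'0.
have := vv' (size v); rewrite take_size_cat // => ->//.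
rewrite -!size_eq0 in v0 v'0; by rewrite size_cat lt0n v0 /= -[ltnLHS]addn0 ltn_add2l lt0n.
Qed.

(** The intervals of these words lie in the cell of [y] and cover its interior, so their union has
    the measure of the cell. *)
Lemma weight_first_sample y : weight R (first_sample y) = (p y)%:E.
Proof.
have itvE b c : lebesgue_measure [set` Interval (BSide b (lo y)) (BSide c (hi y))] = (p y)%:E.
  rewrite lebesgue_measure_itv /= lte_fin hiE ltrDl; case: ltP => h.
    by rewrite -EFinB addrAC subrr add0r.
  by congr _%:E; apply/eqP; rewrite eq_le h p_ge0.
rewrite weight_dyadic; last exact: prefix_free_first_sample.
have mU : measurable (\bigcup_(v in first_sample y) @dyadic R v : set (measurableTypeR R)).
  rewrite (_ : bigcup _ _ = \bigcup_v (if `[< first_sample y v >] then @dyadic R v else set0)).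
    by apply: countable_bigcup_measurable => v; case: ifP => // _; exact: measurable_itv.
  apply/seteqP; split=> u [v uA wu]; first by exists v => //; rewrite asboolT.
  by move: wu; case: asboolP => // Av wu; exists v.
apply/eqP; rewrite eq_le; apply/andP; split.
  rewrite -(itvE true true); apply: le_measure; rewrite ?inE //=.
  move=> u [v [_ /sampleP[h1 h2] _]]; rewrite /dyadic /= !in_itv /= => /andP[h3 h4].
  by rewrite (le_trans h1 h3) (lt_le_trans h4 h2).
(* The left end is excluded: if it is not dyadic, every dyadic interval containing it starts outside
   the cell. *)
rewrite -(itvE false true); apply: le_measure; rewrite ?inE //=.
move=> u; rewrite /= in_itv /= => /andP[lu uh].
have u01 : 0 <= u < 1.
  rewrite (lt_le_trans uh) ?F_le1 // andbT (le_trans _ (ltW lu)) //.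
  by apply: sumr_ge0.
have inD n : dyadic (bits u n) u by apply/dyadicP; rewrite size_bits.
have : exists n, (0 < n)%N && sample (bits u n).
  (* An interval around [u] shorter than the distance from [u] to both ends lies in the cell. *)
  have [|n n0 ne] := @small_dyadic R (Num.min (u - lo y) (hi y - u)).
    by rewrite lt_min !subr_gt0 lu.
  exists n; rewrite n0 /=; rewrite lt_min in ne; case/andP: ne => ne1 ne2.
  have -> // : sample (bits u n) = Some y.
  apply/sampleP; have := inD n; rewrite /dyadic /= in_itv /= size_bits => /andP[d1 d2].
  by rewrite /inside size_bits; split; lra.
(* The minimal length at which anything is sampled; [cell_uniq] at [u] shows that it is [y]. *)
move=> /ex_minnP[n /andP[n0]]; case E: (sample _) => [z|//] _ nmin.
exists (bits u n) => //; have zy : z = y.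
  move/sampleP: E => -[h1 h2].
  have := inD n; rewrite /dyadic /= in_itv /= => /andP[d1 d2].
  apply: (@cell_uniq u); last by rewrite ltW.
  by rewrite (le_trans h1 d1) (lt_le_trans d2 h2).
split; first by rewrite -size_eq0 size_bits -lt0n.
  by rewrite E zy.
move=> k; rewrite size_bits => /andP[k0 kn]; rewrite take_bits 1?ltnW //.
case Ek: (sample _) => [z'|//]; have := nmin k.
by rewrite k0 Ek leqNgt kn => /(_ isT).
Qed.

End sampler.

(** * The tree that simulates a chain *)

Section sampling_tree.
Variables (R : realType) (Sigma : Type) (M : markov_chain R Sigma) (s : M).

Let pick (x : M) := sample (mc_trans M x).

Definition sampling_step (c : M * seq bool) (b : bool) : M * seq bool :=
  if pick c.1 (rcons c.2 b) is Some y then (y, [::]) else (c.1, rcons c.2 b).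

(* The last state of [M] chosen on the way to a node, with the coin tosses made
   since then. *)
Definition sampling (n : seq bool) := foldl sampling_step (s, [::]) n.

(** No pending toss means that a choice has just been made, or that the node is the root, which
    shows [s]. *)
Definition sampled (n : seq bool) : option M :=
  if (sampling n).2 is [::] then Some (sampling n).1 else None.

(** The pending tosses [v] are arbitrary for the sake of the induction; with [v] empty the right
    side is [first_sample]. *)
Lemma hits_sampled n x v u y : sampling n = (x, v) ->
  hits sampled n [:: y] u <->
  [/\ u != [::], pick x (v ++ u) = Some y &
    forall k, (0 < k < size u)%N -> pick x (v ++ take k u) = None].
Proof.
elim: u n v => [|b u IH] n v nxv; first by split=> [[]|[]].
have sn : sampling (rcons n b) = sampling_step (x, v) b.
  by rewrite /sampling -cats1 foldl_cat -/(sampling n) nxv.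
rewrite hits_cons /sampled sn /sampling_step /=.
case E: (pick x (rcons v b)) => [z|] /=.
  rewrite hits_nil; split=> [[zy ->]|[_ yE kE]].
    by split=> //; [rewrite cats1 E zy|case=> [|[]]].
  case: u {IH} yE kE => [|b' u] yE kE; last by have := kE 1%N isT; rewrite /= cats1 E.
  by move: yE; rewrite cats1 E => -[->].
have -> : (if rcons v b is [::] then Some x else None) = None by case: (v).
have -> := IH (rcons n b) (rcons v b); last by rewrite sn /sampling_step /= E.
rewrite cat_rcons; split=> -[u0 yE kE]; split=> //.
- by move=> [|[|k]] //= ku; [rewrite take0 cats1|rewrite -cat_rcons; exact: kE].
- by apply: contra_eq_neq yE => ->; rewrite cats1 E.
- by move=> k /andP[_ ku]; rewrite cat_rcons; exact: (kE k.+1 ku).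
Qed.

Lemma sampled_trans n x y : sampled n = Some x ->
  weight R (hits sampled n [:: y]) = (mc_trans M x y)%:E.
Proof.
rewrite {1}/sampled; case E: (sampling n) => [z [|//]] /= [zx]; rewrite zx in E.
rewrite -(weight_first_sample (@mc_trans_ge0 _ _ M x) (mc_trans_sum1 x)).
by congr weight; apply/seteqP; split=> u /(hits_sampled u y E).
Qed.

End sampling_tree.

Lemma mc_sat_bin_sat (R : realType) (Sigma : Type) (phi : state_formula Sigma) :
  MC_SAT R phi -> BIN_SAT R (bin_formula phi).
Proof.
move=> [M [s sphi]].
pose t n := omap (mc_label M) (sampled s n).
have tlab n : setT n -> t n = omap (mc_label M) (sampled s n) by [].
have ttr n x y : setT n -> sampled s n = Some x ->
    weight R (hits (sampled s) n [:: y]) = (mc_trans M x y)%:E.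
  by move=> _; exact: sampled_trans.
have D_cat n (u : seq bool) : setT n -> setT (n ++ u) by [].
exists t, [::]; split; first split.
- by [].
- exact: (infinitely_visible_as D_cat tlab ttr).
have [tr _] := tr_sat s D_cat tlab ttr.
exact/(tr phi [::] s).
Qed.

(* Assembling the reduction *)
Local Close Scope ring_scope.
Local Close Scope classical_set_scope.

Theorem theorem25 (R : realType) :
  (exists c : nat, forall Sigma : finType,
     exists f : state_formula Sigma -> state_formula (option Sigma),
       [/\ computable f,
           forall phi, state_size (f phi) <= c * state_size phi,
           forall phi, MC_SAT R phi <-> BIN_SAT R (f phi) &
           forall phi, state_prob_only phi -> state_prob_only (f phi)])
  /\
  (forall Sigma : finType,
     linearly_reduces (@MC_SAT R Sigma) (@BIN_SAT R (option Sigma))).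
Proof.
have sat_iff (Sigma : finType) (phi : state_formula Sigma) :
    MC_SAT R phi <-> BIN_SAT R (bin_formula phi).
  by split; [exact: mc_sat_bin_sat|exact: bin_sat_mc_sat].
split=> [|Sigma]; last first.
  exists (@bin_formula Sigma); split=> //; first exact: bin_formula_linear_time.
  by exists 22 => phi; exact: bin_formula_size.
exists 22 => Sigma; exists (@bin_formula Sigma); split=> //.
- have [T [c Tc]] := bin_formula_linear_time Sigma.
  by exists T => phi; have [n _ Tn] := Tc phi; exists n.
- exact: bin_formula_size.
- exact: bin_formula_prob_only.
Qed.
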